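(* Let $\Omega\subset\mathbb{C}$ be a bounded connected open set, $\varphi:\mathbb{D}\to\Omega$ an analytic covering map and $\overline{\varphi}$ its extension by radial limits. Let $p,q\in\overline\Omega$, $z\in\Omega$, and $\widehat z\in\mathbb{D}$ with $\varphi(\widehat z)=z$. (1) If $\gamma$ is a path in $\Omega$ (e.p.e.) joining $p$ and $q$ with $\gamma(s_0)=z$ for some $s_0\in[0,1]$, then there is a unique path $\widehat\gamma$ in $\mathbb{D}$ (e.p.e.) with $\overline{\varphi}\circ\widehat\gamma=\gamma$ and $\widehat\gamma(s_0)=\widehat z$. (2) If $h:[0,1]\times[0,1]\to\mathbb{C}$ is continuous such that for every $t\in[0,1]$ the path $h_t=h(\cdot,t)$ is a path in $\Omega$ (e.p.e.) joining $p$ and $q$, and $h(s_0,0)=z$ for some $s_0\in[0,1]$, then there is a unique continuous $\widehat h:[0,1]\times[0,1]\to\overline{\mathbb{D}}$ such that $\widehat h(s,t)\in\mathbb{D}$ and $\varphi(\widehat h(s,t))=h(s,t)$ for all $(s,t)\in(0,1)\times[0,1]$, $\widehat h(\{0\}\times[0,1])$ is a single point $\widehat p$ with $\overline\varphi(\widehat p)=p$, $\widehat h(\{1\}\times[0,1])$ is a single point $\widehat q$ with $\overline\varphi(\widehat q)=q$, and $\widehat h(s_0,0)=\widehat z$.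
   Context: $\mathbb{D}=\{z\in\mathbb{C}:|z|<1\}$. A path in $\Omega$ (e.p.e.) joining $p$ and $q$ is a continuous $\gamma:[0,1]\to\mathbb{C}$ with $\gamma(0)=p$, $\gamma(1)=q$, $\gamma((0,1))\subset\Omega$; similarly for paths in $\mathbb{D}$ (e.p.e.). The extended covering map $\overline\varphi$ is defined on $\mathbb{D}\cup\{\alpha\in\partial\mathbb{D}:\lim_{r\to1^-}\varphi(r\alpha)\text{ exists}\}$ by $\overline\varphi=\varphi$ on $\mathbb{D}$ and $\overline\varphi(\alpha)=\lim_{r\to1^-}\varphi(r\alpha)$ for such $\alpha\in\partial\mathbb{D}$ (not necessarily continuous at points of $\partial\mathbb{D}$). *)

(* Defs.v *)
From Stdlib Require Import Reals Lra.
Open Scope R_scope.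

Definition Cplx : Type := (R * R)%type.

Definition Cadd (z w : Cplx) : Cplx := (fst z + fst w, snd z + snd w).
Definition Csub (z w : Cplx) : Cplx := (fst z - fst w, snd z - snd w).
Definition Cmul (z w : Cplx) : Cplx :=
  (fst z * fst w - snd z * snd w, fst z * snd w + snd z * fst w).
Definition Cscal (r : R) (z : Cplx) : Cplx := (r * fst z, r * snd z).
Definition Cnorm (z : Cplx) : R := sqrt (fst z * fst z + snd z * snd z).
Definition Cdist (z w : Cplx) : R := Cnorm (Csub z w).

Definition Disc (z : Cplx) : Prop := Cnorm z < 1.
Definition cDisc (z : Cplx) : Prop := Cnorm z <= 1.

Definition Csubset (A B : Cplx -> Prop) : Prop := forall z, A z -> B z.

Definition Copen_set (U : Cplx -> Prop) : Prop :=
  forall z, U z -> exists r, 0 < r /\ forall w, Cdist w z < r -> U w.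

Definition Cconnected (U : Cplx -> Prop) : Prop :=
  forall A B : Cplx -> Prop, Copen_set A -> Copen_set B ->
    (forall z, U z -> A z \/ B z) ->
    (forall z, U z -> A z -> B z -> False) ->
    (exists z, U z /\ A z) -> (exists z, U z /\ B z) -> False.

Definition Cbounded (U : Cplx -> Prop) : Prop :=
  exists M, forall z, U z -> Cnorm z <= M.

Definition Cclosure (U : Cplx -> Prop) (z : Cplx) : Prop :=
  forall eps, 0 < eps -> exists w, U w /\ Cdist w z < eps.

Definition Ccontinuous_on (S : Cplx -> Prop) (f : Cplx -> Cplx) : Prop :=
  forall z, S z -> forall eps, 0 < eps -> exists delta, 0 < delta /\
    forall w, S w -> Cdist w z < delta -> Cdist (f w) (f z) < eps.

Definition Cholomorphic_on (S : Cplx -> Prop) (f : Cplx -> Cplx) : Prop :=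
  forall z, S z -> exists f' : Cplx, forall eps, 0 < eps -> exists delta, 0 < delta /\
    forall w, S w -> Cdist w z < delta ->
      Cnorm (Csub (Csub (f w) (f z)) (Cmul f' (Csub w z))) <= eps * Cdist w z.

Definition covering_map (phi : Cplx -> Cplx) (Om : Cplx -> Prop) : Prop :=
  Ccontinuous_on Disc phi /\
  (forall z, Disc z -> Om (phi z)) /\
  (forall w, Om w -> exists z, Disc z /\ phi z = w) /\
  (forall w, Om w -> exists V : Cplx -> Prop, Copen_set V /\ V w /\ Csubset V Om /\
     exists (I : Type) (U : I -> Cplx -> Prop),
       (forall i, Copen_set (U i) /\ Csubset (U i) Disc) /\
       (forall i j z, U i z -> U j z -> i = j) /\
       (forall z, Disc z -> (V (phi z) <-> exists i, U i z)) /\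
       (forall i, exists g : Cplx -> Cplx,
          (forall v, V v -> U i (g v) /\ phi (g v) = v) /\
          (forall u, U i u -> g (phi u) = u) /\
          Ccontinuous_on V g)).

Definition radial_limit (phi : Cplx -> Cplx) (a v : Cplx) : Prop :=
  forall eps, 0 < eps -> exists delta, 0 < delta /\
    forall r, 1 - delta < r < 1 -> Cdist (phi (Cscal r a)) v < eps.

(* Graph of the extended map phibar: phibar a = v. phibar is defined on the
   disc and at boundary points where the radial limit exists. *)
Definition phibar (phi : Cplx -> Cplx) (a v : Cplx) : Prop :=
  (Disc a /\ phi a = v) \/ (Cnorm a = 1 /\ radial_limit phi a v).

(* Paths (maps R -> Cplx, only their values on [0,1] matter). *)
Definition continuous_path (g : R -> Cplx) : Prop :=
  forall s, 0 <= s <= 1 -> forall eps, 0 < eps -> exists delta, 0 < delta /\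
    forall s', 0 <= s' <= 1 -> Rabs (s' - s) < delta -> Cdist (g s') (g s) < eps.

Definition path_epe (S : Cplx -> Prop) (p q : Cplx) (g : R -> Cplx) : Prop :=
  g 0 = p /\ g 1 = q /\ continuous_path g /\
  (forall s, 0 < s < 1 -> S (g s)).

Definition continuous_square (h : R -> R -> Cplx) : Prop :=
  forall s t, 0 <= s <= 1 -> 0 <= t <= 1 -> forall eps, 0 < eps ->
    exists delta, 0 < delta /\
    forall s' t', 0 <= s' <= 1 -> 0 <= t' <= 1 ->
      Rabs (s' - s) < delta -> Rabs (t' - t) < delta ->
      Cdist (h s' t') (h s t) < eps.

Definition lift_homotopy (phi : Cplx -> Cplx) (p q zh : Cplx) (s0 : R)
    (h hh : R -> R -> Cplx) : Prop :=
  continuous_square hh /\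
  (forall s t, 0 <= s <= 1 -> 0 <= t <= 1 -> cDisc (hh s t)) /\
  (forall s t, 0 < s < 1 -> 0 <= t <= 1 -> Disc (hh s t) /\ phi (hh s t) = h s t) /\
  (exists ph, (forall t, 0 <= t <= 1 -> hh 0 t = ph) /\ phibar phi ph p) /\
  (exists qh, (forall t, 0 <= t <= 1 -> hh 1 t = qh) /\ phibar phi qh q) /\
  hh s0 0 = zh.

(* Main.v *)
Require Import Defs.
From Stdlib Require Import Reals Lra Lia Classical ClassicalEpsilon.
From Coquelicot Require Import Coquelicot.
Open Scope R_scope.

(** Away from the edges the lift is the usual covering space lift, obtained by lifting segments.
    Part (1) is part (2) for a homotopy that does not depend on [t].  The analytic point is the
    behaviour at an edge over a point [p] outside [Om].  There [f = (phi - p) / M] has no zeros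
    and is bounded by [1], and everything follows from one quantitative form of Koebe's lemma:
    if [|f| < eps] on a path in the disc that runs from the half plane [Re <= 0] into the sector
    [|Im| <= Re], then [|f 0| ^ 8 <= eps].  Precomposed with a Moebius map, it shows that the
    lift cannot have two cluster points at the edge, and (Lindeloef's theorem) that the radial
    limit at its only cluster point is [p].

    For the estimate itself, the path may be assumed to run from the positive real axis to a
    diagonal.  The product [h] of the four rotations by [i ^ k] of [f z * conj (f (conj z))] is
    invariant under [z -> i z], and [|h| < eps] on the path and on its mirror image, which
    together join some [w] to [i w].  In the logarithmic coordinate, a primitive of [h ^ N] has
    increment [i pi / 2 * h(0) ^ N] between these two points, while integrating along the path
    bounds this increment by [K * eps ^ N], with [K] independent of [N]. *)

(** * Goursat's theorem and potentials on a half plane *)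

(** The parameter r of the Moebius map is what gives the estimate its two uses. A second cluster
    point is excluded with r fixed and eps arbitrarily small: the zero-free f would have to vanish
    at r b. For Lindeloef's theorem eps is fixed and r tends to 1, while the starting point of the
    path stays put. The exponent 8 counts the factors of h at the origin, four rotations of a
    product of two, each of modulus |f 0|. The sector |Im| <= Re is dictated by the quarter turn,
    which is the angle between a diagonal and its mirror image. The obstacle is that the lifted path
    need not be rectifiable, so smallness of |h| along it bounds no integral with a known constant;
    passing to N-th powers makes the unknown polygon length harmless. The logarithmic coordinate is
    used because a half plane, unlike the punctured disc, has primitives. Over a point of [Om] an
    edge needs no analysis: the lift there is the lift of a constant path. *)

Definition rect_integral (P Q : R -> R -> R) (a b c d : R) : R :=
  (RInt (fun x => P x c) a b + RInt (fun y => Q b y) c d)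
  - (RInt (fun x => P x d) a b + RInt (fun y => Q a y) c d).

(** The shared number [py] says that the form P dx + Q dy is closed at the point. Only
    differentiability is asked for, without continuity of the partial derivatives, hence Goursat's
    bisection instead of Green's formula. The circulation of this form, counterclockwise, is
    [rect_integral]. *)
Definition closed_form_at (P Q : R -> R -> R) (x y : R) : Prop :=
  exists px py qy, differentiable_pt_lim P x y px py /\ differentiable_pt_lim Q x y py qy.

Lemma differentiable_continuous_x (P : R -> R -> R) (x y lx ly : R) :
  differentiable_pt_lim P x y lx ly -> continuous (fun u => P u y) x.
Proof.
  intros H. apply continuity_pt_filterlim, derivable_continuous_pt.
  exists (lx * 1 + ly * 0).
  apply (derivable_pt_lim_comp_2d P (fun u => u) (fun _ => y)); auto.
  apply derivable_pt_lim_id. apply derivable_pt_lim_const.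
Qed.

Lemma differentiable_continuous_y (P : R -> R -> R) (x y lx ly : R) :
  differentiable_pt_lim P x y lx ly -> continuous (fun v => P x v) y.
Proof.
  intros H. apply continuity_pt_filterlim, derivable_continuous_pt.
  exists (lx * 0 + ly * 1).
  apply (derivable_pt_lim_comp_2d P (fun _ => x) (fun v => v)); auto.
  apply derivable_pt_lim_const. apply derivable_pt_lim_id.
Qed.

Lemma ex_RInt_Px (P Q : R -> R -> R) (a b y : R) :
  (forall x, Rmin a b <= x <= Rmax a b -> closed_form_at P Q x y) ->
  ex_RInt (fun x => P x y) a b.
Proof.
  intros H. apply (ex_RInt_continuous (V := R_CompleteNormedModule)). intros x Hx.
  destruct (H x Hx) as (px & py & qy & H1 & _).
  eapply differentiable_continuous_x; eauto.
Qed.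

Lemma ex_RInt_Qy (P Q : R -> R -> R) (c d x : R) :
  (forall y, Rmin c d <= y <= Rmax c d -> closed_form_at P Q x y) ->
  ex_RInt (fun y => Q x y) c d.
Proof.
  intros H. apply (ex_RInt_continuous (V := R_CompleteNormedModule)). intros y Hy.
  destruct (H y Hy) as (px & py & qy & _ & H1).
  eapply differentiable_continuous_y; eauto.
Qed.

Lemma RInt_Chasles_R (f : R -> R) (a b c : R) :
  ex_RInt f a b -> ex_RInt f b c -> RInt f a c = RInt f a b + RInt f b c.
Proof. intros H1 H2. symmetry. exact (RInt_Chasles f a b c H1 H2). Qed.

Lemma RInt_near_const (f : R -> R) (a b k e : R) :
  a <= b -> ex_RInt f a b -> (forall t, a <= t <= b -> Rabs (f t - k) <= e) ->
  Rabs (RInt f a b - k * (b - a)) <= e * (b - a).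
Proof.
  intros Hab Hf Hb.
  replace (RInt f a b - k * (b - a)) with (RInt (fun t => f t - k) a b).
  - rewrite (Rmult_comm e). apply abs_RInt_le_const; auto.
    apply (ex_RInt_minus (V := R_NormedModule)); auto. apply ex_RInt_const.
  - rewrite (RInt_minus (V := R_CompleteNormedModule) f (fun _ => k)); auto.
    + rewrite (RInt_const (V := R_CompleteNormedModule)).
      unfold minus, plus, opp, scal; simpl. unfold mult; simpl. ring.
    + apply ex_RInt_const.
Qed.

Definition rect_in (D : R -> R -> Prop) (a b c d : R) : Prop :=
  forall x y, a <= x <= b -> c <= y <= d -> D x y.

Lemma rect_quarter (P Q : R -> R -> R) (a b c d m n : R) :
  a <= m <= b -> c <= n <= d ->
  rect_in (closed_form_at P Q) a b c d ->
  rect_integral P Q a b c d =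
    rect_integral P Q a m c n + rect_integral P Q m b c n
    + rect_integral P Q a m n d + rect_integral P Q m b n d.
Proof.
  intros Hm Hn HD. unfold rect_in in HD.
  assert (Ex : forall u v y, a <= u -> u <= v -> v <= b -> c <= y <= d ->
                ex_RInt (fun x => P x y) u v).
  { intros u v y Hu Huv Hv Hy. apply ex_RInt_Px with Q.
    intros x Hx. rewrite Rmin_left, Rmax_right in Hx by lra. apply HD; lra. }
  assert (Ey : forall u v x, c <= u -> u <= v -> v <= d -> a <= x <= b ->
                ex_RInt (fun y => Q x y) u v).
  { intros u v x Hu Huv Hv Hx. apply ex_RInt_Qy with P.
    intros y Hy. rewrite Rmin_left, Rmax_right in Hy by lra. apply HD; lra. }
  unfold rect_integral.
  rewrite (RInt_Chasles_R (fun x => P x c) a m b) by (apply Ex; lra).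
  rewrite (RInt_Chasles_R (fun x => P x d) a m b) by (apply Ex; lra).
  rewrite (RInt_Chasles_R (fun y => Q b y) c n d) by (apply Ey; lra).
  rewrite (RInt_Chasles_R (fun y => Q a y) c n d) by (apply Ey; lra).
  ring.
Qed.

(** Between opposite edges the terms in [px] and [qy] cancel and leave the constants [py * (c - d)]
    and [py * (b - a)]. Their integrals cancel because the form is closed, so only the errors
    survive. *)
Lemma rect_integral_bound (P Q : R -> R -> R) (a b c d x0 y0 px py qy e : R) :
  a <= b -> c <= d -> 
  rect_in (closed_form_at P Q) a b c d ->
  (forall x y, a <= x <= b -> c <= y <= d ->
     Rabs (P x y - P x0 y0 - (px * (x - x0) + py * (y - y0))) <= e) ->
  (forall x y, a <= x <= b -> c <= y <= d ->
     Rabs (Q x y - Q x0 y0 - (py * (x - x0) + qy * (y - y0))) <= e) ->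
  Rabs (rect_integral P Q a b c d) <= 2 * e * ((b - a) + (d - c)).
Proof.
  intros Hab Hcd HD HP HQ.
  assert (Ex : forall y, c <= y <= d -> ex_RInt (fun x => P x y) a b).
  { intros y Hy. apply ex_RInt_Px with Q.
    intros x Hx. rewrite Rmin_left, Rmax_right in Hx by lra. apply HD; lra. }
  assert (Ey : forall x, a <= x <= b -> ex_RInt (fun y => Q x y) c d).
  { intros x Hx. apply ex_RInt_Qy with P.
    intros y Hy. rewrite Rmin_left, Rmax_right in Hy by lra. apply HD; lra. }
  assert (E1 : RInt (fun x => P x c) a b - RInt (fun x => P x d) a b
               = RInt (fun x => P x c - P x d) a b).
  { symmetry. apply (RInt_minus (V := R_CompleteNormedModule)); apply Ex; lra. }
  assert (E2 : RInt (fun y => Q b y) c d - RInt (fun y => Q a y) c d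
               = RInt (fun y => Q b y - Q a y) c d).
  { symmetry. apply (RInt_minus (V := R_CompleteNormedModule)); apply Ey; lra. }
  assert (B1 := RInt_near_const (fun x => P x c - P x d) a b (py * (c - d)) (2 * e) Hab).
  assert (B2 := RInt_near_const (fun y => Q b y - Q a y) c d (py * (b - a)) (2 * e) Hcd).
  assert (B1' : Rabs (RInt (fun x => P x c - P x d) a b - py * (c - d) * (b - a))
                <= 2 * e * (b - a)).
  { apply B1. apply (ex_RInt_minus (V := R_NormedModule)); apply Ex; lra.
    intros t Ht. generalize (HP t c Ht ltac:(lra)) (HP t d Ht ltac:(lra)).
    unfold Rabs; repeat destruct Rcase_abs; lra. }
  assert (B2' : Rabs (RInt (fun y => Q b y - Q a y) c d - py * (b - a) * (d - c))
                <= 2 * e * (d - c)).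
  { apply B2. apply (ex_RInt_minus (V := R_NormedModule)); apply Ey; lra.
    intros t Ht. generalize (HQ b t ltac:(lra) Ht) (HQ a t ltac:(lra) Ht).
    unfold Rabs; repeat destruct Rcase_abs; lra. }
  unfold rect_integral.
  replace (_ - _) with
    ((RInt (fun x => P x c - P x d) a b - py * (c - d) * (b - a)) +
     (RInt (fun y => Q b y - Q a y) c d - py * (b - a) * (d - c)))
    by (rewrite <- E1, <- E2; ring).
  eapply Rle_trans. apply Rabs_triang. lra.
Qed.

Lemma nested_intervals (a b : nat -> R) :
  (forall n, a n <= a (S n)) -> (forall n, b (S n) <= b n) -> (forall n, a n <= b n) ->
  exists x, forall n, a n <= x <= b n.
Proof.
  intros Ha Hb Hab.
  assert (Ma : forall n k, a n <= a (n + k)%nat).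
  { intros n k; induction k. rewrite Nat.add_0_r; lra.
    rewrite Nat.add_succ_r. eapply Rle_trans; eauto. }
  assert (Mb : forall n k, b (n + k)%nat <= b n).
  { intros n k; induction k. rewrite Nat.add_0_r; lra.
    rewrite Nat.add_succ_r. eapply Rle_trans; eauto. }
  assert (AB : forall n k, a n <= b k).
  { intros n k. apply Rle_trans with (a (n + k)%nat); auto.
    apply Rle_trans with (b (n + k)%nat); auto. rewrite Nat.add_comm; auto. }
  destruct (completeness (fun x => exists n, x = a n)) as [x [Hx1 Hx2]].
  - exists (b O). intros x [n ->]. auto.
  - exists (a O), O. auto.
  - exists x. intros n. split. apply Hx1; exists n; auto.
    apply Hx2. intros y [k ->]. auto.
Qed.

Record rect := mkrect { rl : R; rr : R; rb : R; rt : R }.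

Definition is_quarter (r s : rect) : Prop :=
  rl r <= rl s /\ rr s <= rr r /\ rb r <= rb s /\ rt s <= rt r /\
  rr s - rl s = (rr r - rl r) / 2 /\ rt s - rb s = (rt r - rb r) / 2.

Definition rintegral (P Q : R -> R -> R) (r : rect) : R :=
  rect_integral P Q (rl r) (rr r) (rb r) (rt r).

Lemma quarter_step (P Q : R -> R -> R) (r : rect) :
  rl r <= rr r -> rb r <= rt r ->
  rect_in (closed_form_at P Q) (rl r) (rr r) (rb r) (rt r) ->
  exists s, is_quarter r s /\ Rabs (rintegral P Q r) <= 4 * Rabs (rintegral P Q s).
Proof.
  intros H1 H2 HD.
  set (m := (rl r + rr r) / 2). set (n := (rb r + rt r) / 2).
  assert (E := rect_quarter P Q (rl r) (rr r) (rb r) (rt r) m n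
                 ltac:(unfold m; lra) ltac:(unfold n; lra) HD).
  assert (Q1 : is_quarter r (mkrect (rl r) m (rb r) n))
    by (unfold is_quarter, m, n; simpl; lra).
  assert (Q2 : is_quarter r (mkrect m (rr r) (rb r) n))
    by (unfold is_quarter, m, n; simpl; lra).
  assert (Q3 : is_quarter r (mkrect (rl r) m n (rt r)))
    by (unfold is_quarter, m, n; simpl; lra).
  assert (Q4 : is_quarter r (mkrect m (rr r) n (rt r)))
    by (unfold is_quarter, m, n; simpl; lra).
  apply NNPP; intros HN.
  assert (K : forall s, is_quarter r s -> 4 * Rabs (rintegral P Q s) < Rabs (rintegral P Q r)).
  { intros s Hs. apply Rnot_le_lt. intros Hl. apply HN. exists s; auto. }
  apply K in Q1, Q2, Q3, Q4. unfold rintegral in *; simpl in *. rewrite E in Q1, Q2, Q3, Q4.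
  revert Q1 Q2 Q3 Q4. unfold Rabs; repeat destruct Rcase_abs; lra.
Qed.

(** The integral loses at most a factor 4 per bisection, while linearisation at the common point
    bounds it by a small multiple of the squared half-perimeter, which loses exactly a factor 4. *)
Lemma goursat_rect (P Q : R -> R -> R) (a b c d : R) :
  a <= b -> c <= d -> rect_in (closed_form_at P Q) a b c d ->
  rect_integral P Q a b c d = 0.
Proof.
  intros Hab Hcd HD.
  set (ok := fun r => rl r <= rr r /\ rb r <= rt r /\
               rect_in (closed_form_at P Q) (rl r) (rr r) (rb r) (rt r)).
  assert (St : forall r, exists s, ok r ->
            is_quarter r s /\ Rabs (rintegral P Q r) <= 4 * Rabs (rintegral P Q s)).
  { intros r. destruct (classic (ok r)) as [Hr|Hr].
    - destruct (quarter_step P Q r) as [s Hs]; try apply Hr. exists s; auto.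
    - exists r. tauto. }
  set (step := fun r => proj1_sig (constructive_indefinite_description _ (St r))).
  assert (Hstep : forall r, ok r -> is_quarter r (step r) /\
            Rabs (rintegral P Q r) <= 4 * Rabs (rintegral P Q (step r))).
  { intros r. unfold step. destruct constructive_indefinite_description as [s Hs]; simpl; auto. }
  set (r0 := mkrect a b c d).
  set (rn := fix rn n := match n with O => r0 | S n => step (rn n) end).
  assert (Hok : forall n, ok (rn n)).
  { induction n. repeat split; simpl; auto.
    destruct (Hstep _ IHn) as [(A1 & A2 & A3 & A4 & A5 & A6) _].
    destruct IHn as (B1 & B2 & B3). simpl. repeat split; try lra.
    intros x y Hx Hy. apply B3; lra. }
  assert (HI : forall n, Rabs (rintegral P Q r0) <= 4 ^ n * Rabs (rintegral P Q (rn n))).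
  { induction n. simpl; lra.
    destruct (Hstep _ (Hok n)) as [_ H]. change (step (rn n)) with (rn (S n)) in H.
    assert (0 < 4 ^ n) by (apply pow_lt; lra). simpl pow.
    eapply Rle_trans; [exact IHn|]. rewrite (Rmult_comm 4), Rmult_assoc.
    apply Rmult_le_compat_l; lra. }
  set (p0 := (b - a) + (d - c)).
  set (p := fun r => (rr r - rl r) + (rt r - rb r)).
  assert (Hp : forall n, p (rn n) * 2 ^ n = p0).
  { induction n. unfold p; simpl; unfold p0; ring.
    destruct (Hstep _ (Hok n)) as [(_ & _ & _ & _ & A5 & A6) _].
    rewrite <- IHn. unfold p. simpl. rewrite A5, A6. field. }
  destruct (nested_intervals (fun n => rl (rn n)) (fun n => rr (rn n))) as [x0 Hx0].
  { intros n. apply (proj1 (Hstep _ (Hok n))). }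
  { intros n. apply (proj1 (Hstep _ (Hok n))). }
  { intros n. apply (Hok n). }
  destruct (nested_intervals (fun n => rb (rn n)) (fun n => rt (rn n))) as [y0 Hy0].
  { intros n. apply (proj1 (Hstep _ (Hok n))). }
  { intros n. apply (proj1 (Hstep _ (Hok n))). }
  { intros n. apply (Hok n). }
  destruct (HD x0 y0 (Hx0 O) (Hy0 O)) as (px & py & qy & DP & DQ).
  destruct (Req_dec (rect_integral P Q a b c d) 0) as [|Hne]; auto. exfalso.
  apply Rabs_pos_lt in Hne. set (I0 := Rabs (rect_integral P Q a b c d)) in *.
  assert (Hp0 : 0 <= p0) by (unfold p0; lra).
  (* Chosen so that the final bound [2 * eps * (p0 * p0)] stays below [I0]; the added 1 covers a
     degenerate rectangle. *)
  assert (Heps : 0 < I0 / (4 * (p0 * p0 + 1))).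
  { apply Rdiv_lt_0_compat; nra. }
  set (eps := mkposreal _ Heps).
  destruct (DP eps) as [d1 H1]. destruct (DQ eps) as [d2 H2].
  assert (Hd : 0 < Rmin d1 d2) by (apply Rmin_pos; apply cond_pos).
  assert (Hn : exists n, p (rn n) < Rmin d1 d2).
  { destruct (Pow_x_infinity 2 ltac:(rewrite Rabs_right; lra) (p0 / Rmin d1 d2 + 1)) as [N HN].
    exists N. specialize (HN N (le_n N)). rewrite Rabs_right in HN
      by (apply Rle_ge, pow_le; lra).
    assert (H2N : 0 < 2 ^ N) by (apply pow_lt; lra).
    apply Rmult_lt_reg_r with (2 ^ N); auto. rewrite Hp.
    apply Rlt_le_trans with (Rmin d1 d2 * (p0 / Rmin d1 d2 + 1)).
    - field_simplify; lra.
    - apply Rmult_le_compat_l; lra. }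
  destruct Hn as [n Hn].
  destruct (Hok n) as (O1 & O2 & O3). generalize (Hx0 n) (Hy0 n); intros X0 Y0.
  assert (PP : 0 <= p (rn n)) by (unfold p; lra).
  assert (Hm1 := Rmin_l d1 d2). assert (Hm2 := Rmin_r d1 d2).
  assert (MX : forall x y, rl (rn n) <= x <= rr (rn n) -> rb (rn n) <= y <= rt (rn n) ->
     Rabs (x - x0) <= p (rn n) /\ Rabs (y - y0) <= p (rn n)).
  { intros x y Hx Hy. unfold p. split; apply Rabs_le; lra. }
  assert (B := rect_integral_bound P Q (rl (rn n)) (rr (rn n)) (rb (rn n)) (rt (rn n))
     x0 y0 px py qy (eps * p (rn n)) O1 O2 O3).
  assert (B' : Rabs (rintegral P Q (rn n)) <= 2 * (eps * p (rn n)) * p (rn n)).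
  { apply B.
    - intros x y Hx Hy. destruct (MX x y Hx Hy).
      eapply Rle_trans. apply H1; lra.
      apply Rmult_le_compat_l. apply Rlt_le, cond_pos. apply Rmax_lub; auto.
    - intros x y Hx Hy. destruct (MX x y Hx Hy).
      eapply Rle_trans. apply H2; lra.
      apply Rmult_le_compat_l. apply Rlt_le, cond_pos. apply Rmax_lub; auto. }
  assert (F := HI n). change (Rabs (rintegral P Q r0)) with I0 in F.
  assert (F4 : 4 ^ n = 2 ^ n * 2 ^ n) by (rewrite <- Rpow_mult_distr; f_equal; lra).
  rewrite F4 in F.
  assert (H2n : 0 < 2 ^ n) by (apply pow_lt; lra).
  assert (F' : I0 <= 2 * eps * (p0 * p0)).
  { eapply Rle_trans. exact F. rewrite <- (Hp n).
    apply Rle_trans with (2 ^ n * 2 ^ n * (2 * (eps * p (rn n)) * p (rn n))).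
    - apply Rmult_le_compat_l; nra.
    - right; ring. }
  assert (G : eps * (4 * (p0 * p0 + 1)) = I0) by (simpl; field; nra).
  assert (0 < eps) by apply cond_pos. nra.
Qed.

Lemma RInt_swap_R (f : R -> R) (a b : R) : ex_RInt f a b -> RInt f b a = - RInt f a b.
Proof. intros H. symmetry. exact (opp_RInt_swap f a b H). Qed.

(** The corners may come in any order: exchanging [a] with [b], or [c] with [d], only changes the
    sign of the circulation. *)
Lemma goursat_halfplane (P Q : R -> R -> R) (a b c d : R) :
  (forall x y, x < 0 -> closed_form_at P Q x y) -> a < 0 -> b < 0 ->
  rect_integral P Q a b c d = 0.
Proof.
  intros HD.
  assert (Ex : forall u v y, u < 0 -> v < 0 -> ex_RInt (fun x => P x y) u v).
  { intros u v y Hu Hv. apply ex_RInt_Px with Q. intros x Hx. apply HD.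
    eapply Rle_lt_trans. apply Hx. apply Rmax_lub_lt; auto. }
  assert (Ey : forall u v x, x < 0 -> ex_RInt (fun y => Q x y) u v).
  { intros u v x Hx. apply ex_RInt_Qy with P. intros y Hy. auto. }
  assert (K : forall a b c d, a < 0 -> b < 0 -> a <= b -> rect_integral P Q a b c d = 0).
  { clear a b c d. intros a b c d Ha Hb Hab. destruct (Rle_dec c d) as [H|H].
    - apply goursat_rect; auto. intros x y Hx Hy. apply HD; lra.
    - assert (G : rect_integral P Q a b d c = 0).
      { apply goursat_rect; auto. lra. intros x y Hx Hy. apply HD; lra. }
      unfold rect_integral in *.
      rewrite (RInt_swap_R (fun y => Q b y) d c), (RInt_swap_R (fun y => Q a y) d c) by auto.
      lra. }
  intros Ha Hb. destruct (Rle_dec a b) as [H|H]. auto.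
  assert (G := K b a c d Hb Ha ltac:(lra)). unfold rect_integral in *.
  rewrite (RInt_swap_R (fun x => P x c) b a), (RInt_swap_R (fun x => P x d) b a) by auto.
  lra.
Qed.

Lemma RInt_near_const_abs (f : R -> R) (a b k e : R) :
  ex_RInt f a b -> (forall t, Rmin a b <= t <= Rmax a b -> Rabs (f t - k) <= e) ->
  Rabs (RInt f a b - k * (b - a)) <= e * Rabs (b - a).
Proof.
  intros Hf Hb. destruct (Rle_dec a b) as [H|H].
  - rewrite (Rabs_right (b - a)) by lra. apply RInt_near_const; auto.
    rewrite Rmin_left, Rmax_right in Hb by lra. auto.
  - rewrite (Rabs_left (b - a)) by lra. rewrite (RInt_swap_R f b a) by (apply ex_RInt_swap; auto).
    rewrite Rmin_right, Rmax_left in Hb by lra.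
    assert (G := RInt_near_const f b a k e ltac:(lra) (ex_RInt_swap _ _ _ Hf) Hb).
    rewrite <- Rabs_Ropp. replace (- (_ - _)) with (RInt f b a - k * (a - b)) by ring. lra.
Qed.

(** [U] integrates along the axis and then vertically. By Goursat its increment is also the integral
    over a short horizontal and a short vertical segment, and continuity of [P] and [Q] turns these
    two integrals into the differential. *)
Lemma potential_halfplane (P Q : R -> R -> R) :
  (forall x y, x < 0 -> closed_form_at P Q x y) ->
  exists U, forall x y, x < 0 -> differentiable_pt_lim U x y (P x y) (Q x y).
Proof.
  intros HD.
  assert (Ex : forall u v y, u < 0 -> v < 0 -> ex_RInt (fun x => P x y) u v).
  { intros u v y Hu Hv. apply ex_RInt_Px with Q. intros x Hx. apply HD.
    eapply Rle_lt_trans. apply Hx. apply Rmax_lub_lt; auto. }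
  assert (Ey : forall u v x, x < 0 -> ex_RInt (fun y => Q x y) u v).
  { intros u v x Hx. apply ex_RInt_Qy with P. intros y Hy. auto. }
  set (U := fun x y => RInt (fun t => P t 0) (-1) x + RInt (fun t => Q x t) 0 y).
  exists U. intros x y Hx eps.
  assert (Inc : forall x' y', x' < 0 ->
            U x' y' - U x y = RInt (fun t => P t y) x x' + RInt (fun t => Q x' t) y y').
  { intros x' y' Hx'. unfold U.
    rewrite (RInt_Chasles_R (fun t => P t 0) (-1) x x') by (apply Ex; lra).
    rewrite (RInt_Chasles_R (fun t => Q x' t) 0 y y') by (apply Ey; lra).
    assert (G := goursat_halfplane P Q x x' 0 y HD Hx Hx'). unfold rect_integral in G. lra. }
  destruct (HD x y Hx) as (px & py & qy & DP & DQ).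
  assert (HCP : continuity_2d_pt P x y)
    by (apply differentiable_continuity_pt; exists px, py; auto).
  assert (HCQ : continuity_2d_pt Q x y)
    by (apply differentiable_continuity_pt; exists py, qy; auto).
  assert (He : 0 < eps / 2) by (generalize (cond_pos eps); lra).
  destruct (HCP (mkposreal _ He)) as [d1 H1].
  destruct (HCQ (mkposreal _ He)) as [d2 H2].
  simpl in H1, H2.
  assert (Hd : 0 < Rmin (Rmin d1 d2) (- x)).
  { repeat apply Rmin_pos; try apply cond_pos; lra. }
  exists (mkposreal _ Hd). simpl. intros u v Hu Hv.
  assert (M1 := Rmin_l (Rmin d1 d2) (- x)). assert (M2 := Rmin_r (Rmin d1 d2) (- x)).
  assert (M3 := Rmin_l d1 d2). assert (M4 := Rmin_r d1 d2).
  assert (Hu0 : u < 0).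
  { apply Rabs_def2 in Hu. lra. }
  rewrite Inc by auto.
  assert (B1 : Rabs (RInt (fun t => P t y) x u - P x y * (u - x)) <= eps / 2 * Rabs (u - x)).
  { apply RInt_near_const_abs; auto. intros t Ht. left. apply H1.
    - eapply Rle_lt_trans; [|eapply Rlt_le_trans; [exact Hu|lra]].
      revert Ht. unfold Rmin, Rmax, Rabs. repeat destruct Rle_dec; repeat destruct Rcase_abs; lra.
    - rewrite Rminus_diag, Rabs_R0. apply cond_pos. }
  assert (B2 : Rabs (RInt (fun t => Q u t) y v - Q x y * (v - y)) <= eps / 2 * Rabs (v - y)).
  { apply RInt_near_const_abs; auto. intros t Ht. left. apply H2. lra.
    eapply Rle_lt_trans; [|eapply Rlt_le_trans; [exact Hv|lra]].
    revert Ht. unfold Rmin, Rmax, Rabs. repeat destruct Rle_dec; repeat destruct Rcase_abs; lra. }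
  replace (_ - _) with ((RInt (fun t => P t y) x u - P x y * (u - x)) +
     (RInt (fun t => Q u t) y v - Q x y * (v - y))) by ring.
  eapply Rle_trans. apply Rabs_triang.
  assert (N1 := Rmax_l (Rabs (u - x)) (Rabs (v - y))).
  assert (N2 := Rmax_r (Rabs (u - x)) (Rabs (v - y))). nra.
Qed.

(** * Complex derivatives *)

(** Connectedness of a segment as an induction principle. [P] holds at some point just below the
    supremum and is transferred from there to a point beyond it, unless the supremum is [b]. It
    serves for lifting, for uniqueness, for continuity in parameters and for compactness. *)
Lemma interval_ind (P : R -> Prop) (a b : R) :
  a <= b -> P a ->
  (forall s, a <= s <= b -> exists d, 0 < d /\ forall x y, a <= x <= b -> a <= y <= b ->
     Rabs (x - s) < d -> Rabs (y - s) < d -> P x -> P y) ->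
  P b.
Proof.
  intros Hab Pa Hloc.
  destruct (completeness (fun x => a <= x <= b /\ P x)) as [s [Hs1 Hs2]].
  - exists b. intros x Hx; lra.
  - exists a; split; [lra|auto].
  - assert (Has : a <= s) by (apply Hs1; split; [lra|auto]).
    assert (Hsb : s <= b) by (apply Hs2; intros x Hx; lra).
    destruct (Hloc s ltac:(lra)) as (d & Hd & H).
    assert (Hx : exists x, a <= x <= b /\ P x /\ s - d < x <= s).
    { apply NNPP. intros HN. assert (s <= s - d); [|lra].
      apply Hs2. intros x [Hx Px]. apply Rnot_lt_le. intros Hl. apply HN.
      exists x. repeat split; try lra; auto. }
    destruct Hx as (x & Hx & Px & Hxs).
    set (y := Rmin b (s + d / 2)).
    assert (Hy : a <= y <= b) by (unfold y, Rmin; destruct Rle_dec; lra).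
    assert (Hy2 : s <= y <= s + d / 2) by (unfold y, Rmin; destruct Rle_dec; lra).
    assert (Py : P y).
    { apply (H x y); auto; apply Rabs_def1; lra. }
    assert (y <= s) by (apply Hs1; auto).
    assert (y = b) by (unfold y, Rmin in *; destruct Rle_dec; lra).
    congruence.
Qed.

Definition ccont (f : C -> C) (z : C) : Prop :=
  forall eps, 0 < eps -> exists d, 0 < d /\
    forall w, Cmod (w - z) < d -> Cmod (f w - f z) < eps.

(* Caratheodory's form of complex differentiability. *)
Definition Cderiv (f : C -> C) (z l : C) : Prop :=
  exists q, q z = l /\ ccont q z /\
    exists d, 0 < d /\ forall w, Cmod (w - z) < d -> (f w = f z + q w * (w - z))%C.

Lemma Cmod_triangle3 (a b c : C) : Cmod (a - c) <= Cmod (a - b) + Cmod (b - c).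
Proof. replace (a - c)%C with ((a - b) + (b - c))%C by ring. apply Cmod_triangle. Qed.

Lemma Cmod_sub_comm (a b : C) : Cmod (a - b) = Cmod (b - a).
Proof. rewrite <- Cmod_opp. f_equal. ring. Qed.

Lemma Cmod_sub_rev (a b : C) : Cmod a - Cmod b <= Cmod (a - b).
Proof.
  assert (H := Cmod_triangle (a - b) b). replace (a - b + b)%C with a in H by ring. lra.
Qed.

Lemma Cmod_sub_diag (a : C) : Cmod (a - a) = 0.
Proof. replace (a - a)%C with (RtoC 0) by ring. apply Cmod_0. Qed.

Lemma Cmod_le_abs (z : C) : Cmod z <= Rabs (fst z) + Rabs (snd z).
Proof.
  destruct z as [x y]; simpl. replace (x, y) with (RtoC x + Ci * RtoC y)%C.
  - eapply Rle_trans. apply Cmod_triangle. rewrite Cmod_mult, Cmod_Ci, !Cmod_R. lra.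
  - unfold Cplus, Cmult, RtoC, Ci; simpl. f_equal; ring.
Qed.

Lemma fst_le_Cmod (z : C) : Rabs (fst z) <= Cmod z.
Proof. eapply Rle_trans; [apply Rmax_l|apply Rmax_Cmod]. Qed.

Lemma snd_le_Cmod (z : C) : Rabs (snd z) <= Cmod z.
Proof. eapply Rle_trans; [apply Rmax_r|apply Rmax_Cmod]. Qed.

Lemma ccont_const (c z : C) : ccont (fun _ => c) z.
Proof. intros e He. exists 1. split. lra. intros. rewrite Cmod_sub_diag. auto. Qed.

Lemma ccont_id (z : C) : ccont (fun w => w) z.
Proof. intros e He. exists e. auto. Qed.

Lemma ccont_plus (f g : C -> C) (z : C) :
  ccont f z -> ccont g z -> ccont (fun w => f w + g w)%C z.
Proof.
  intros Hf Hg e He.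
  destruct (Hf (e/2) ltac:(lra)) as (d1 & P1 & H1).
  destruct (Hg (e/2) ltac:(lra)) as (d2 & P2 & H2).
  exists (Rmin d1 d2). split. apply Rmin_pos; auto. intros w Hw.
  specialize (H1 w (Rlt_le_trans _ _ _ Hw (Rmin_l _ _))).
  specialize (H2 w (Rlt_le_trans _ _ _ Hw (Rmin_r _ _))).
  replace (f w + g w - (f z + g z))%C with ((f w - f z) + (g w - g z))%C by ring.
  eapply Rle_lt_trans. apply Cmod_triangle. lra.
Qed.

Lemma ccont_comp (f g : C -> C) (z : C) :
  ccont g z -> ccont f (g z) -> ccont (fun w => f (g w)) z.
Proof.
  intros Hg Hf e He. destruct (Hf e He) as (d1 & P1 & H1).
  destruct (Hg d1 P1) as (d2 & P2 & H2). exists d2; auto.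
Qed.

Lemma ccont_mult (f g : C -> C) (z : C) :
  ccont f z -> ccont g z -> ccont (fun w => f w * g w)%C z.
Proof.
  intros Hf Hg e He.
  set (A := Cmod (f z)). set (B := Cmod (g z)).
  assert (HA : 0 <= A) by apply Cmod_ge_0. assert (HB : 0 <= B) by apply Cmod_ge_0.
  set (k := Rmin 1 (e / (A + B + 1))).
  assert (Hk : 0 < k) by (apply Rmin_pos; [lra|apply Rdiv_lt_0_compat; lra]).
  assert (Hk1 : k <= 1) by apply Rmin_l.
  assert (Hk2 : k * (A + B + 1) <= e).
  { apply Rle_trans with (e / (A + B + 1) * (A + B + 1)).
    - apply Rmult_le_compat_r. lra. apply Rmin_r.
    - right; field; lra. }
  destruct (Hf k Hk) as (d1 & P1 & H1). destruct (Hg k Hk) as (d2 & P2 & H2).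
  exists (Rmin d1 d2). split. apply Rmin_pos; auto. intros w Hw.
  specialize (H1 w (Rlt_le_trans _ _ _ Hw (Rmin_l _ _))).
  specialize (H2 w (Rlt_le_trans _ _ _ Hw (Rmin_r _ _))).
  replace (f w * g w - f z * g z)%C with
    ((f w - f z) * (g w - g z) + ((f w - f z) * g z + f z * (g w - g z)))%C by ring.
  eapply Rle_lt_trans. apply Cmod_triangle.
  eapply Rle_lt_trans. apply Rplus_le_compat_l, Cmod_triangle.
  rewrite !Cmod_mult. fold A B.
  assert (0 <= Cmod (f w - f z)) by apply Cmod_ge_0.
  assert (0 <= Cmod (g w - g z)) by apply Cmod_ge_0.
  assert (Cmod (f w - f z) * Cmod (g w - g z) < k) by nra. nra.
Qed.

Lemma ccont_inv (z : C) : z <> 0 -> ccont Cinv z.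
Proof.
  intros Hz e He. assert (Hm : 0 < Cmod z) by (apply Cmod_gt_0; auto).
  set (m := Cmod z) in *.
  exists (Rmin (m / 2) (e * m * m / 2)).
  assert (0 < e * m) by nra.
  split. apply Rmin_pos; nra. intros w Hw.
  assert (H1 := Rlt_le_trans _ _ _ Hw (Rmin_l _ _)).
  assert (H2 := Rlt_le_trans _ _ _ Hw (Rmin_r _ _)).
  assert (H3 := Cmod_sub_rev z w). rewrite Cmod_sub_comm in H3. fold m in H3.
  assert (Hw0 : w <> 0) by (apply Cmod_gt_0; lra).
  replace (/ w - / z)%C with ((z - w) * / (w * z))%C by (field; auto).
  rewrite Cmod_mult, Cmod_inv, Cmod_mult, Cmod_sub_comm by (apply Cmult_neq_0; auto). fold m.
  apply Rmult_lt_reg_r with (Cmod w * m). nra.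
  rewrite Rmult_assoc, Rinv_l by nra. rewrite Rmult_1_r.
  eapply Rlt_le_trans. exact H2. nra.
Qed.

Lemma ccont_conj (z : C) : ccont Cconj z.
Proof.
  intros e He. exists e. split; auto. intros w Hw.
  replace (Cconj w - Cconj z)%C with (Cconj (w - z)).
  rewrite Cmod_conj; auto. destruct w, z. unfold Cconj, Cminus, Cplus, Copp; simpl. f_equal; ring.
Qed.

Lemma ccont_local (f g : C -> C) (z : C) (d : R) :
  0 < d -> (forall w, Cmod (w - z) < d -> f w = g w) -> ccont f z -> ccont g z.
Proof.
  intros Hd He Hf e Hep. destruct (Hf e Hep) as (d1 & P1 & H1).
  exists (Rmin d d1). split. apply Rmin_pos; auto. intros w Hw.
  rewrite <- !He. apply H1. eapply Rlt_le_trans; [exact Hw|apply Rmin_r].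
  rewrite Cmod_sub_diag; auto. eapply Rlt_le_trans; [exact Hw|apply Rmin_l].
Qed.

Lemma Cderiv_ccont (f : C -> C) (z l : C) : Cderiv f z l -> ccont f z.
Proof.
  intros (q & _ & Hq & d & Hd & H).
  apply ccont_local with (fun w => f z + q w * (w - z))%C d; auto.
  - intros w Hw; symmetry; auto.
  - apply ccont_plus. apply ccont_const. apply ccont_mult; auto.
    apply (ccont_plus (fun w => w) (fun _ => - z)%C). apply ccont_id. apply ccont_const.
Qed.

Lemma Cderiv_const (c z : C) : Cderiv (fun _ => c) z 0.
Proof.
  exists (fun _ => RtoC 0). repeat split. apply ccont_const.
  exists 1; split. lra. intros; ring.
Qed.

Lemma Cderiv_id (z : C) : Cderiv (fun w => w) z 1.
Proof.
  exists (fun _ => RtoC 1). repeat split. apply ccont_const.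
  exists 1; split. lra. intros; ring.
Qed.

Lemma Cderiv_plus (f g : C -> C) (z a b : C) :
  Cderiv f z a -> Cderiv g z b -> Cderiv (fun w => f w + g w)%C z (a + b)%C.
Proof.
  intros (q1 & E1 & C1 & d1 & P1 & H1) (q2 & E2 & C2 & d2 & P2 & H2).
  exists (fun w => q1 w + q2 w)%C. rewrite E1, E2. split; auto. split. apply ccont_plus; auto.
  exists (Rmin d1 d2). split. apply Rmin_pos; auto. intros w Hw.
  rewrite (H1 w (Rlt_le_trans _ _ _ Hw (Rmin_l _ _))).
  rewrite (H2 w (Rlt_le_trans _ _ _ Hw (Rmin_r _ _))). ring.
Qed.

Lemma Cderiv_mult (f g : C -> C) (z a b : C) :
  Cderiv f z a -> Cderiv g z b -> Cderiv (fun w => f w * g w)%C z (a * g z + f z * b)%C.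
Proof.
  intros Hf Hg. assert (Cg := Cderiv_ccont _ _ _ Hg).
  destruct Hf as (q1 & E1 & C1 & d1 & P1 & H1). destruct Hg as (q2 & E2 & C2 & d2 & P2 & H2).
  exists (fun w => q1 w * g w + f z * q2 w)%C. rewrite E1, E2. split; auto. split.
  - apply ccont_plus; apply ccont_mult; auto. apply ccont_const.
  - exists (Rmin d1 d2). split. apply Rmin_pos; auto. intros w Hw.
    rewrite (H1 w (Rlt_le_trans _ _ _ Hw (Rmin_l _ _))).
    rewrite (H2 w (Rlt_le_trans _ _ _ Hw (Rmin_r _ _))). ring.
Qed.

Lemma Cderiv_comp (f g : C -> C) (z a b : C) :
  Cderiv g z a -> Cderiv f (g z) b -> Cderiv (fun w => f (g w)) z (b * a)%C.
Proof.
  intros Hg (q1 & E1 & C1 & d1 & P1 & H1). assert (Cg := Cderiv_ccont _ _ _ Hg).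
  destruct Hg as (q2 & E2 & C2 & d2 & P2 & H2).
  destruct (Cg d1 P1) as (d3 & P3 & H3).
  exists (fun w => q1 (g w) * q2 w)%C. rewrite E1, E2. split; auto. split.
  - apply ccont_mult; auto. apply ccont_comp; auto.
  - exists (Rmin d2 d3). split. apply Rmin_pos; auto. intros w Hw.
    rewrite (H1 (g w)) by (apply H3; eapply Rlt_le_trans; [exact Hw|apply Rmin_r]).
    rewrite (H2 w (Rlt_le_trans _ _ _ Hw (Rmin_l _ _))) at 2. ring.
Qed.

Lemma Cderiv_scal (c z : C) (f : C -> C) (a : C) :
  Cderiv f z a -> Cderiv (fun w => c * f w)%C z (c * a)%C.
Proof.
  intros H. replace (c * a)%C with (0 * f z + c * a)%C by ring.
  apply (Cderiv_mult (fun _ => c)); auto. apply Cderiv_const.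
Qed.

Lemma Cderiv_conj (f : C -> C) (z a : C) :
  Cderiv f (Cconj z) a -> Cderiv (fun w => Cconj (f (Cconj w))) z (Cconj a).
Proof.
  intros (q & E & Cq & d & P & H).
  exists (fun w => Cconj (q (Cconj w))). rewrite E. split; auto. split.
  - apply (ccont_comp Cconj (fun w => q (Cconj w))). apply ccont_comp; auto.
    apply ccont_conj. apply ccont_conj.
  - assert (Hc : forall u v, Cconj (u + v) = (Cconj u + Cconj v)%C).
    { intros [] []. unfold Cconj, Cplus; simpl. f_equal; ring. }
    assert (Hm : forall u v, Cconj (u * v) = (Cconj u * Cconj v)%C).
    { intros [] []. unfold Cconj, Cmult; simpl. f_equal; ring. }
    assert (Hs : forall u v, Cconj (u - v) = (Cconj u - Cconj v)%C).
    { intros [] []. unfold Cconj, Cminus, Cplus, Copp; simpl. f_equal; ring. }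
    exists d. split; auto. intros w Hw.
    rewrite (H (Cconj w)) by (rewrite <- Hs, Cmod_conj; auto).
    rewrite Hc, Hm, Hs, !Cconj_conj. auto.
Qed.

Lemma Cderiv_pow (f : C -> C) (z a : C) (n : nat) :
  Cderiv f z a -> exists b, Cderiv (fun w => f w ^ n)%C z b.
Proof.
  intros H. induction n as [|n [b Hb]].
  - exists 0. apply (Cderiv_const 1).
  - eexists. apply (Cderiv_mult f (fun w => f w ^ n)%C); eauto.
Qed.

Lemma Cderiv_of_eps (f : C -> C) (z l : C) :
  (forall eps, 0 < eps -> exists d, 0 < d /\ forall w, Cmod (w - z) < d ->
     Cmod (f w - f z - l * (w - z)) <= eps * Cmod (w - z)) -> Cderiv f z l.
Proof.
  intros H.
  set (q := fun w => if excluded_middle_informative (w = z) then l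
                     else ((f w - f z) / (w - z))%C).
  exists q. split; [|split].
  - unfold q. destruct excluded_middle_informative; congruence.
  - intros e He. destruct (H (e/2) ltac:(lra)) as (d & Hd & HH). exists d. split; auto.
    intros w Hw. unfold q at 2. destruct excluded_middle_informative; [|congruence].
    unfold q. destruct excluded_middle_informative as [->|Hn].
    + rewrite Cmod_sub_diag. auto.
    + assert (Hne : (w - z)%C <> 0) by (intros E; apply Hn; replace w with (w - z + z)%C by ring; rewrite E; ring).
      replace ((f w - f z) / (w - z) - l)%C with ((f w - f z - l * (w - z)) / (w - z))%C
        by (field; auto).
      rewrite Cmod_div by auto. apply Cmod_gt_0 in Hne. specialize (HH w Hw).
      apply Rle_lt_trans with (e / 2); [|lra].
      apply Rmult_le_reg_r with (Cmod (w - z)); auto. unfold Rdiv at 1.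
      rewrite Rmult_assoc, Rinv_l; lra.
  - exists 1. split. lra. intros w _. unfold q. destruct excluded_middle_informative as [->|Hn].
    + ring.
    + assert (Hne : (w - z)%C <> 0) by (intros E; apply Hn; replace w with (w - z + z)%C by ring; rewrite E; ring).
      field. auto.
Qed.

Lemma Cderiv_eps (f : C -> C) (z l : C) :
  Cderiv f z l -> forall eps, 0 < eps -> exists d, 0 < d /\ forall w, Cmod (w - z) < d ->
     Cmod (f w - f z - l * (w - z)) <= eps * Cmod (w - z).
Proof.
  intros (q & E & Cq & d & P & H) e He. destruct (Cq e He) as (d1 & P1 & H1).
  exists (Rmin d d1). split. apply Rmin_pos; auto. intros w Hw.
  rewrite (H w (Rlt_le_trans _ _ _ Hw (Rmin_l _ _))).
  replace (f z + q w * (w - z) - f z - l * (w - z))%C with ((q w - q z) * (w - z))%C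
    by (rewrite E; ring).
  rewrite Cmod_mult. apply Rmult_le_compat_r. apply Cmod_ge_0.
  left. apply H1. eapply Rlt_le_trans; [exact Hw|apply Rmin_r].
Qed.

Lemma Cmod_pair_bounds (u v x y : R) :
  Rmax (Rabs (u - x)) (Rabs (v - y)) <= Cmod ((u, v) - (x, y)) <=
    2 * Rmax (Rabs (u - x)) (Rabs (v - y)).
Proof.
  split. apply (Rmax_Cmod ((u, v) - (x, y))%C).
  eapply Rle_trans. apply Cmod_le_abs. simpl.
  change (u + - x) with (u - x). change (v + - y) with (v - y).
  generalize (Rmax_l (Rabs (u - x)) (Rabs (v - y))) (Rmax_r (Rabs (u - x)) (Rabs (v - y))). lra.
Qed.

(** The Cauchy-Riemann equations, read off from the matrix of multiplication by [(a, b)].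
    [differentiable_pt_lim] measures increments in the sup norm, comparable to [Cmod] up to a factor
    2, hence the halved tolerances. *)
Lemma Cderiv_components (f : C -> C) (x y a b : R) :
  Cderiv f (x, y) (a, b) <->
  differentiable_pt_lim (fun u v => fst (f (u, v))) x y a (- b) /\
  differentiable_pt_lim (fun u v => snd (f (u, v))) x y b a.
Proof.
  assert (Ef : forall u v, fst (f (u, v) - f (x, y) - (a, b) * ((u, v) - (x, y)))%C =
     fst (f (u, v)) - fst (f (x, y)) - (a * (u - x) + - b * (v - y))).
  { intros; simpl; ring. }
  assert (Es : forall u v, snd (f (u, v) - f (x, y) - (a, b) * ((u, v) - (x, y)))%C =
     snd (f (u, v)) - snd (f (x, y)) - (b * (u - x) + a * (v - y))).
  { intros; simpl; ring. }
  split.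
  - intros H.
    assert (K : forall eps : posreal, exists d : posreal, forall u v,
       Rabs (u - x) < d -> Rabs (v - y) < d ->
       Cmod (f (u, v) - f (x, y) - (a, b) * ((u, v) - (x, y)))%C <=
         eps * Rmax (Rabs (u - x)) (Rabs (v - y))).
    { intros eps. assert (He := cond_pos eps).
      destruct (Cderiv_eps _ _ _ H (eps / 2) ltac:(lra)) as (d & Hd & HH).
      assert (Hd2 : 0 < d / 2) by lra. exists (mkposreal _ Hd2). simpl. intros u v Hu Hv.
      destruct (Cmod_pair_bounds u v x y) as [_ B].
      assert (Rmax (Rabs (u - x)) (Rabs (v - y)) < d / 2) by (apply Rmax_lub_lt; auto).
      eapply Rle_trans. apply HH. lra. nra. }
    split; intros eps; destruct (K eps) as [d Hd]; exists d; intros u v Hu Hv.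
    + rewrite <- Ef. eapply Rle_trans. apply fst_le_Cmod. auto.
    + rewrite <- Es. eapply Rle_trans. apply snd_le_Cmod. auto.
  - intros [H1 H2]. apply Cderiv_of_eps. intros e He.
    assert (He2 : 0 < e / 2) by lra.
    destruct (H1 (mkposreal _ He2)) as [d1 K1]. destruct (H2 (mkposreal _ He2)) as [d2 K2].
    simpl in K1, K2.
    exists (Rmin d1 d2). split. apply Rmin_pos; apply cond_pos. intros [u v] Hw.
    destruct (Cmod_pair_bounds u v x y) as [B _].
    assert (U := Rmax_l (Rabs (u - x)) (Rabs (v - y))).
    assert (V := Rmax_r (Rabs (u - x)) (Rabs (v - y))).
    assert (M1 := Rmin_l d1 d2). assert (M2 := Rmin_r d1 d2).
    eapply Rle_trans. apply Cmod_le_abs. rewrite Ef, Es.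
    specialize (K1 u v ltac:(lra) ltac:(lra)). specialize (K2 u v ltac:(lra) ltac:(lra)). nra.
Qed.

(** For G = u + i v the Cauchy-Riemann equations say that u dx - v dy and v dx + u dy are closed;
    their potentials are the two components of a primitive. *)
Lemma primitive_halfplane (G : C -> C) :
  (forall z, fst z < 0 -> exists l, Cderiv G z l) ->
  exists F, forall z, fst z < 0 -> Cderiv F z (G z).
Proof.
  intros H.
  destruct (potential_halfplane (fun x y => fst (G (x, y))) (fun x y => - snd (G (x, y))))
    as [U1 HU1].
  { intros x y Hx. destruct (H (x, y) Hx) as [[a b] Hd].
    apply Cderiv_components in Hd. destruct Hd as [D1 D2].
    exists a, (- b), (- a). split; auto.
    intros eps. destruct (D2 eps) as [d Hd]. exists d. intros u v Hu Hv.
    specialize (Hd u v Hu Hv). rewrite <- Rabs_Ropp. simpl in Hd.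
    replace (- _) with (snd (G (u, v)) - snd (G (x, y)) - (b * (u - x) + a * (v - y))) by ring.
    auto. }
  destruct (potential_halfplane (fun x y => snd (G (x, y))) (fun x y => fst (G (x, y))))
    as [U2 HU2].
  { intros x y Hx. destruct (H (x, y) Hx) as [[a b] Hd].
    apply Cderiv_components in Hd. destruct Hd as [D1 D2].
    exists b, a, (- b). auto. }
  exists (fun z => (U1 (fst z) (snd z), U2 (fst z) (snd z))).
  intros [x y] Hx. rewrite (surjective_pairing (G (x, y))). apply Cderiv_components. simpl. auto.
Qed.

(** The mean value theorem is applied to the real and the imaginary part separately; the
    intermediate points differ, which costs the factor 2. *)
Lemma Cderiv_bound (F G : C -> C) (B : R) (a b : C) :
  (forall t, 0 <= t <= 1 -> Cderiv F (a + t * (b - a)) (G (a + t * (b - a)))%C) ->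
  (forall t, 0 <= t <= 1 -> Cmod (G (a + t * (b - a))%C) <= B) ->
  Cmod (F b - F a) <= 2 * B * Cmod (b - a).
Proof.
  intros HF HG. destruct a as [x y], b as [u v].
  set (px := fun t => x + t * (u - x)). set (py := fun t => y + t * (v - y)).
  assert (Ep : forall t : R, ((x, y) + t * ((u, v) - (x, y)))%C = (px t, py t)).
  { intros t. unfold px, py, Cplus, Cmult, Cminus, Copp; simpl. f_equal; ring. }
  assert (Dx : forall t, derivable_pt_lim px t (u - x)).
  { intros t. apply is_derive_Reals. unfold px. auto_derive; auto. ring. }
  assert (Dy : forall t, derivable_pt_lim py t (v - y)).
  { intros t. apply is_derive_Reals. unfold py. auto_derive; auto. ring. }
  assert (D : forall t, 0 <= t <= 1 ->
    derivable_pt_lim (fun t => fst (F (px t, py t))) t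
       (fst (G (px t, py t) * ((u, v) - (x, y)))%C) /\
    derivable_pt_lim (fun t => snd (F (px t, py t))) t
       (snd (G (px t, py t) * ((u, v) - (x, y)))%C)).
  { intros t Ht. specialize (HF t Ht). rewrite Ep in HF.
    destruct (G (px t, py t)) as [g h] eqn:EG.
    apply Cderiv_components in HF. destruct HF as [H1 H2]. split.
    - replace (fst _) with (g * (u - x) + - h * (v - y)) by (simpl; ring).
      apply (derivable_pt_lim_comp_2d (fun u v => fst (F (u, v))) px py); auto.
    - replace (snd _) with (h * (u - x) + g * (v - y)) by (simpl; ring).
      apply (derivable_pt_lim_comp_2d (fun u v => snd (F (u, v))) px py); auto. }
  destruct (MVT_cor2 (fun t => fst (F (px t, py t))) _ 0 1 ltac:(lra) (fun t Ht => proj1 (D t Ht)))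
    as (c1 & E1 & R1).
  destruct (MVT_cor2 (fun t => snd (F (px t, py t))) _ 0 1 ltac:(lra) (fun t Ht => proj2 (D t Ht)))
    as (c2 & E2 & R2).
  assert (P0 : (px 0, py 0) = (x, y)) by (unfold px, py; f_equal; ring).
  assert (P1 : (px 1, py 1) = (u, v)) by (unfold px, py; f_equal; ring).
  rewrite P0, P1 in E1, E2.
  assert (K : forall t, 0 < t < 1 -> Cmod (G (px t, py t) * ((u, v) - (x, y)))%C <=
     B * Cmod ((u, v) - (x, y))).
  { intros t Ht. rewrite Cmod_mult. apply Rmult_le_compat_r. apply Cmod_ge_0.
    rewrite <- Ep. apply HG; lra. }
  eapply Rle_trans. apply Cmod_le_abs.
  change (fst (F (u, v) - F (x, y))%C) with (fst (F (u, v)) - fst (F (x, y))).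
  change (snd (F (u, v) - F (x, y))%C) with (snd (F (u, v)) - snd (F (x, y))).
  rewrite E1, E2, !Rminus_0_r, !Rmult_1_r.
  generalize (fst_le_Cmod (G (px c1, py c1) * ((u, v) - (x, y)))%C) (K c1 R1)
    (snd_le_Cmod (G (px c2, py c2) * ((u, v) - (x, y)))%C) (K c2 R2). lra.
Qed.

Definition cpath (c : R -> C) : Prop :=
  forall s eps, 0 < eps -> exists d, 0 < d /\ forall s', Rabs (s' - s) < d ->
    Cmod (c s' - c s) < eps.

Definition copen (W : C -> Prop) : Prop :=
  forall z, W z -> exists r, 0 < r /\ forall w, Cmod (w - z) < r -> W w.

Lemma segment_in_ball (z a b : C) (r t : R) :
  Cmod (a - z) < r -> Cmod (b - z) < r -> 0 <= t <= 1 -> Cmod (a + t * (b - a) - z) < r.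
Proof.
  intros Ha Hb Ht.
  replace (a + t * (b - a) - z)%C with (RtoC (1 - t) * (a - z) + t * (b - z))%C
    by (rewrite RtoC_minus; ring).
  eapply Rle_lt_trans. apply Cmod_triangle. rewrite !Cmod_mult, !Cmod_R, !Rabs_right by lra.
  destruct (Req_dec t 0) as [->|]. lra. nra.
Qed.

(* The path need not be rectifiable: [L] is the length of an inscribed polygon (doubled by
   [Cderiv_bound]) and, crucially, does not depend on [F]. *)
Lemma primitive_increment_bound (W : C -> Prop) (c : R -> C) :
  copen W -> cpath c -> (forall s, 0 <= s <= 1 -> W (c s)) ->
  exists L, forall (F G : C -> C) (B : R), 0 <= B ->
    (forall z, W z -> Cderiv F z (G z)) -> (forall z, W z -> Cmod (G z) <= B) ->
    Cmod (F (c 1) - F (c 0)) <= L * B.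
Proof.
  intros HW Hc Hin.
  apply (interval_ind (fun s => exists L, forall (F G : C -> C) (B : R), 0 <= B ->
    (forall z, W z -> Cderiv F z (G z)) -> (forall z, W z -> Cmod (G z) <= B) ->
    Cmod (F (c s) - F (c 0)) <= L * B) 0 1).
  - lra.
  - exists 0. intros. rewrite Cmod_sub_diag. lra.
  - intros s Hs. destruct (HW _ (Hin s Hs)) as (r & Hr & Hb).
    destruct (Hc s r Hr) as (d & Hd & Hcd).
    exists d. split; auto. intros x y Hx Hy Hxs Hys [L HL].
    exists (L + 2 * Cmod (c y - c x)). intros F G B HB HF HG.
    specialize (HL F G B HB HF HG).
    assert (I : forall t, 0 <= t <= 1 -> W (c x + t * (c y - c x))%C).
    { intros t Ht. apply Hb. apply segment_in_ball; auto. }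
    assert (K := Cderiv_bound F G B (c x) (c y) (fun t Ht => HF _ (I t Ht))
                   (fun t Ht => HG _ (I t Ht))).
    assert (T := Cmod_triangle3 (F (c y)) (F (c x)) (F (c 0))). nra.
Qed.

(** * The sector estimate *)

Definition cexp (z : C) : C := (exp (fst z) * cos (snd z), exp (fst z) * sin (snd z)).

Lemma differentiable_pt_lim_Rmult (x y : R) : differentiable_pt_lim Rmult x y y x.
Proof.
  intros eps. exists eps. intros u v Hu Hv.
  replace (u * v - x * y - _) with ((u - x) * (v - y)) by ring.
  rewrite Rabs_mult. assert (0 <= Rabs (v - y)) by apply Rabs_pos.
  apply Rmult_le_compat; try apply Rabs_pos. lra. apply Rmax_r.
Qed.

Lemma differentiable_pt_lim_snd (x y : R) : differentiable_pt_lim (fun _ v => v) x y 0 1.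
Proof.
  intros eps. exists eps. intros u v Hu Hv.
  replace (v - y - _) with 0 by ring. rewrite Rabs_R0.
  apply Rmult_le_pos. apply Rlt_le, cond_pos.
  eapply Rle_trans. apply Rabs_pos. apply Rmax_r.
Qed.

Lemma differentiable_pt_lim_sep (f g : R -> R) (x y a b : R) :
  derivable_pt_lim f x a -> derivable_pt_lim g y b ->
  differentiable_pt_lim (fun u v => f u * g v) x y (a * g y) (f x * b).
Proof.
  intros Hf Hg.
  assert (Hg2 : differentiable_pt_lim (fun _ v => g v) x y 0 b).
  { assert (K := differentiable_pt_lim_comp (fun u _ => g u) (fun _ v => v) (fun _ v => v)
       x y b 0 0 1 0 1).
    replace 0 with (b * 0 + 0 * 0) at 1 by ring.
    replace b with (b * 1 + 0 * 1) at 2 by ring. apply K.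
    apply differentiable_pt_lim_proj1_0; auto.
    apply differentiable_pt_lim_snd. apply differentiable_pt_lim_snd. }
  replace (a * g y) with (g y * a + f x * 0) by ring.
  replace (f x * b) with (g y * 0 + f x * b) by ring.
  apply (differentiable_pt_lim_comp Rmult (fun u _ => f u) (fun _ v => g v)); auto.
  apply differentiable_pt_lim_Rmult. apply differentiable_pt_lim_proj1_0; auto.
Qed.

Lemma Cderiv_cexp (z : C) : Cderiv cexp z (cexp z).
Proof.
  destruct z as [x y]. unfold cexp at 2. apply Cderiv_components. simpl. split.
  - replace (- (exp x * sin y)) with (exp x * - sin y) by ring.
    apply (differentiable_pt_lim_sep exp cos); [apply derivable_pt_lim_exp|apply derivable_pt_lim_cos].
  - apply (differentiable_pt_lim_sep exp sin); [apply derivable_pt_lim_exp|apply derivable_pt_lim_sin].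
Qed.

Lemma Cmod_cexp (z : C) : Cmod (cexp z) = exp (fst z).
Proof.
  unfold cexp, Cmod; simpl.
  replace (_ + _) with (exp (fst z) * exp (fst z) * (Rsqr (sin (snd z)) + Rsqr (cos (snd z))))
    by (unfold Rsqr; ring).
  rewrite sin2_cos2, Rmult_1_r. apply sqrt_square. left; apply exp_pos.
Qed.

Lemma Cmod_cexp_lt1 (z : C) : fst z < 0 -> Cmod (cexp z) < 1.
Proof. intros H. rewrite Cmod_cexp, <- exp_0. apply exp_increasing; auto. Qed.

(** A logarithm of [Ci]: translation by it in the logarithmic coordinate is the quarter turn of the
    disc. *)
Definition quarter : C := (0, PI / 2).

Lemma cexp_quarter (z : C) : cexp (z + quarter) = (Ci * cexp z)%C.
Proof.
  destruct z as [x y]. unfold cexp, quarter, Cplus, Cmult, Ci; simpl.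
  rewrite Rplus_0_r, cos_plus, sin_plus, cos_PI2, sin_PI2. f_equal; ring.
Qed.

Definition hol_disc (f : C -> C) : Prop := forall z, Cmod z < 1 -> exists l, Cderiv f z l.

Lemma Cderiv_hcexp (h : C -> C) (z : C) :
  hol_disc h -> fst z < 0 -> exists l, Cderiv (fun z => h (cexp z)) z l.
Proof.
  intros Hh Hz. destruct (Hh (cexp z) (Cmod_cexp_lt1 z Hz)) as [l Hl].
  eexists. apply (Cderiv_comp h cexp). apply Cderiv_cexp. eauto.
Qed.

Lemma Cderiv_translate (F : C -> C) (z a l : C) :
  Cderiv F (z + a) l -> Cderiv (fun w => F (w + a)%C) z l.
Proof.
  intros H. replace l with (l * (1 + 0))%C by ring.
  apply (Cderiv_comp F (fun w => w + a)%C); auto.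
  apply (Cderiv_plus (fun w => w) (fun _ => a)). apply Cderiv_id. apply Cderiv_const.
Qed.

Lemma Cmod_quarter : Cmod quarter = PI / 2.
Proof.
  unfold quarter, Cmod; simpl. replace (_ + _) with ((PI / 2) * (PI / 2)) by ring.
  apply sqrt_square. generalize PI_RGT_0; lra.
Qed.

Lemma exp_small (d : R) : 0 < d -> exists X, X < 0 /\ exp X < d.
Proof.
  intros Hd. exists (Rmin (-1) (ln d - 1)). split.
  - apply Rle_lt_trans with (-1). apply Rmin_l. lra.
  - rewrite <- (exp_ln d) at 2 by auto. apply exp_increasing.
    apply Rle_lt_trans with (ln d - 1). apply Rmin_r. lra.
Qed.

(* Up to a constant factor, this is the mean value property of [h] on circles around [0]. *)
Lemma primitive_quarter_increment (h F : C -> C) :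
  hol_disc h -> (forall z, h (Ci * z)%C = h z) ->
  (forall z, fst z < 0 -> Cderiv F z (h (cexp z))) ->
  forall z, fst z < 0 -> (F (z + quarter) - F z = quarter * h 0)%C.
Proof.
  intros Hh Hi HF z Hz.
  set (D := fun z => (F (z + quarter) + (-1) * F z)%C).
  assert (HD : forall z, fst z < 0 -> Cderiv D z 0).
  { intros u Hu. replace (RtoC 0) with (h (cexp (u + quarter)) + (-1) * h (cexp u))%C
      by (rewrite cexp_quarter, Hi; ring).
    unfold D. apply (Cderiv_plus (fun z => F (z + quarter)%C) (fun z => (-1) * F z)%C).
    - apply Cderiv_translate. apply HF. simpl. lra.
    - apply Cderiv_scal. auto. }
  (* Zero derivative on a convex domain gives constancy, through [Cderiv_bound] with bound 0. *)
  assert (HDc : forall u, fst u < 0 -> D u = D z).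
  { intros u Hu. 
    assert (K := Cderiv_bound D (fun _ => 0) 0 z u).
    assert (Hle : Cmod (D u - D z) <= 2 * 0 * Cmod (u - z)).
    { apply K. intros t Ht. apply HD. simpl. nra. intros t Ht. rewrite Cmod_0. lra. }
    assert (Cmod (D u - D z) = 0) by (generalize (Cmod_ge_0 (D u - D z)); nra).
    apply Cmod_eq_0 in H. replace (D u) with (D u - D z + D z)%C by ring. rewrite H. ring. }
  replace (F (z + quarter) - F z)%C with (D z) by (unfold D; ring).
  (* The constant [D] may be evaluated far to the left, where [cexp] is close to 0 and the integrand
     differs from [h 0] by less than [eta] along the whole segment of length pi / 2. *)
  assert (Hsmall : forall eta, 0 < eta -> Cmod (D z - quarter * h 0) <= 2 * eta * (PI / 2)).
  { intros eta Heta.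
    destruct (Hh 0 ltac:(rewrite Cmod_0; lra)) as [l Hl].
    destruct (Cderiv_ccont _ _ _ Hl eta Heta) as (d & Hd & Hcd).
    destruct (exp_small d Hd) as (X & HX & HXd).
    rewrite <- (HDc (X, 0)) by (simpl; lra).
    set (K := fun z => (F z + (- h 0) * z)%C).
    replace (D (X, 0) - quarter * h 0)%C with (K ((X, 0) + quarter) - K (X, 0))%C
      by (unfold D, K; ring).
    rewrite <- Cmod_quarter.
    replace quarter with ((X, 0) + quarter - (X, 0))%C at 2 by ring.
    apply (Cderiv_bound K (fun z => h (cexp z) + (- h 0) * 1)%C).
    - intros t Ht. unfold K.
      apply (Cderiv_plus F (fun z => (- h 0) * z)%C). apply HF. simpl. lra.
      apply (Cderiv_scal _ _ (fun z => z)). apply Cderiv_id.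
    - intros t Ht. left.
      match goal with |- context [cexp ?A] => set (u := A) end.
      replace (h (cexp u) + - h 0 * 1)%C with (h (cexp u) - h 0)%C by ring.
      apply Hcd. replace (cexp u - 0)%C with (cexp u) by ring. rewrite Cmod_cexp.
      replace (fst u) with X by (unfold u; simpl; ring). auto. }
  assert (E : Cmod (D z - quarter * h 0) = 0).
  { apply Rle_antisym; [|apply Cmod_ge_0]. apply Rnot_lt_le. intros Hp.
    set (m := Cmod (D z - quarter * h 0)) in *.
    assert (HPI := PI_RGT_0).
    assert (K := Hsmall (m / (2 * PI)) ltac:(apply Rdiv_lt_0_compat; lra)).
    replace (2 * (m / (2 * PI)) * (PI / 2)) with (m / 2) in K by (field; lra). lra. }
  apply Cmod_eq_0 in E.
  replace (D z) with (D z - quarter * h 0 + quarter * h 0)%C by ring. rewrite E. ring.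
Qed.

(** If [a] exceeded [e], the powers of [a / e] would exceed every constant. This removes the factor
    [K], about which only its independence of [n] is known. *)
Lemma geometric_domination (a e K : R) :
  0 <= a -> 0 < e -> (forall n : nat, a ^ n <= K * e ^ n) -> a <= e.
Proof.
  intros Ha He H. apply Rnot_lt_le. intros Hlt.
  assert (Hr : 1 < a / e) by (apply Rmult_lt_reg_r with e; auto; field_simplify; lra).
  destruct (Pow_x_infinity (a / e) ltac:(rewrite Rabs_right; lra) (K + 1)) as [N HN].
  specialize (HN N (le_n N)). rewrite Rabs_right in HN by (apply Rle_ge, pow_le; lra).
  unfold Rdiv in HN. rewrite Rpow_mult_distr, pow_inv in HN.
  assert (He' : 0 < e ^ N) by (apply pow_lt; auto).
  specialize (H N).
  assert (a ^ N * / e ^ N <= K).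
  { apply Rmult_le_reg_r with (e ^ N); auto. rewrite Rmult_assoc, Rinv_l by lra. lra. }
  lra.
Qed.

(** * Continuous paths in the plane and their logarithms *)

Lemma cpath_components (c : R -> C) :
  cpath c <-> continuity (fun s => fst (c s)) /\ continuity (fun s => snd (c s)).
Proof.
  split.
  - intros H. split; intros s; apply continuity_pt_locally; intros eps;
    destruct (H s eps (cond_pos eps)) as (d & Hd & Hc); exists (mkposreal d Hd); intros u Hu;
    (eapply Rle_lt_trans; [|apply (Hc u Hu)]).
    apply (fst_le_Cmod (c u - c s)). apply (snd_le_Cmod (c u - c s)).
  - intros [H1 H2] s e He.
    specialize (H1 s). specialize (H2 s). rewrite continuity_pt_locally in H1, H2.
    assert (He2 : 0 < e / 2) by lra.
    destruct (H1 (mkposreal _ He2)) as [d1 K1]. destruct (H2 (mkposreal _ He2)) as [d2 K2].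
    simpl in K1, K2.
    exists (Rmin d1 d2). split. apply Rmin_pos; apply cond_pos. intros u Hu.
    assert (A1 := K1 u (Rlt_le_trans _ _ _ Hu (Rmin_l _ _))).
    assert (A2 := K2 u (Rlt_le_trans _ _ _ Hu (Rmin_r _ _))).
    eapply Rle_lt_trans. apply Cmod_le_abs.
    change (Rabs (fst (c u) - fst (c s)) + Rabs (snd (c u) - snd (c s)) < e). lra.
Qed.

Lemma cpath_comp (f : C -> C) (c : R -> C) :
  cpath c -> (forall s, ccont f (c s)) -> cpath (fun s => f (c s)).
Proof.
  intros Hc Hf s e He. destruct (Hf s e He) as (d & Hd & H).
  destruct (Hc s d Hd) as (d' & Hd' & H'). exists d'. auto.
Qed.

Lemma cpath_reparam (c : R -> C) (k : R -> R) :
  cpath c -> continuity k -> cpath (fun s => c (k s)).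
Proof.
  intros Hc Hk. apply cpath_components. apply cpath_components in Hc. destruct Hc as [H1 H2].
  split; intros s.
  apply (continuity_pt_comp k (fun s => fst (c s))); auto.
  apply (continuity_pt_comp k (fun s => snd (c s))); auto.
Qed.

(** The principal branch of the logarithm: on the right half plane the argument is the arctangent of
    the slope, which is continuous there. *)
Lemma log_path (w : R -> C) :
  cpath w -> (forall s, 0 < fst (w s)) ->
  let z := fun s => (ln (Cmod (w s)), atan (snd (w s) / fst (w s))) in
  cpath z /\ forall s, cexp (z s) = w s.
Proof.
  intros Hw Hp z.
  assert (Hm : forall s, 0 < Cmod (w s)).
  { intros s. eapply Rlt_le_trans; [|apply fst_le_Cmod]. rewrite Rabs_right; auto.
    apply Rle_ge; left; auto. }
  assert (Hcm : continuity (fun s => Cmod (w s))).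
  { intros s. apply continuity_pt_locally. intros eps.
    destruct (Hw s eps (cond_pos eps)) as (d & Hd & H). exists (mkposreal d Hd). intros u Hu.
    eapply Rle_lt_trans; [|apply (H u Hu)].
    assert (A1 := Cmod_sub_rev (w u) (w s)). assert (A2 := Cmod_sub_rev (w s) (w u)).
    rewrite Cmod_sub_comm in A2. apply Rabs_le. lra. }
  apply cpath_components in Hw. destruct Hw as [H1 H2].
  split.
  - apply cpath_components. split; intros s; simpl.
    + apply (continuity_pt_comp (fun s => Cmod (w s)) ln). apply Hcm.
      apply derivable_continuous_pt. exists (/ Cmod (w s)). apply derivable_pt_lim_ln; auto.
    + apply (continuity_pt_comp (fun s => snd (w s) / fst (w s)) atan).
      apply (continuity_pt_div (fun s => snd (w s)) (fun s => fst (w s))); auto.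
      specialize (Hp s); lra. apply derivable_continuous_pt, derivable_pt_atan.
  - intros s. unfold cexp, z; simpl. rewrite exp_ln, cos_atan, sin_atan by auto.
    specialize (Hp s). specialize (Hm s). destruct (w s) as [x y]; simpl in *.
    assert (E : Cmod (x, y) = x * sqrt (1 + (y / x)²)).
    { rewrite <- (sqrt_square x) at 2 by lra. rewrite <- sqrt_mult_alt by nra.
      unfold Cmod; simpl. f_equal. unfold Rsqr. field. lra. }
    assert (Hs : sqrt (1 + (y / x)²) <> 0) by (intros E0; rewrite E0 in E; lra).
    rewrite E. f_equal; field; lra.
Qed.

Lemma sector_estimate (f : C -> C) (w : R -> C) (eps : R) :
  hol_disc f -> (forall z, Cmod z < 1 -> Cmod (f z) <= 1) ->
  cpath w -> (forall s, Cmod (w s) < 1) -> (forall s, 0 < fst (w s)) ->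
  snd (w 0) = 0 -> Rabs (snd (w 1)) = fst (w 1) ->
  0 < eps -> (forall s, Cmod (f (w s)) < eps) ->
  Cmod (f 0) ^ 8 <= eps.
Proof.
  intros Hf Hf1 Hw Hw1 Hwp Hw0 Hwe He Hfe.
  (* All factors have modulus at most 1, so [h] inherits its smallness from a single one: from [f z]
     on the path, and from [f (Cconj z)] on the mirror image. *)
  set (f1 := fun z => (f z * Cconj (f (Cconj z)))%C).
  set (f2 := fun z => (f1 z * f1 (-1 * z))%C).
  set (h := fun z => (f2 z * f2 (Ci * z))%C).
  assert (Dc : forall z, Cmod z < 1 -> Cmod (Cconj z) < 1) by (intros; rewrite Cmod_conj; auto).
  assert (Dn : forall z, Cmod z < 1 -> Cmod (-1 * z) < 1).
  { intros z Hz. replace (-1 * z)%C with (- z)%C by ring. rewrite Cmod_opp; auto. }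
  assert (Di : forall z, Cmod z < 1 -> Cmod (Ci * z) < 1).
  { intros z Hz. rewrite Cmod_mult, Cmod_Ci. lra. }
  assert (hol1 : hol_disc f1).
  { intros z Hz. destruct (Hf z Hz) as [l Hl]. destruct (Hf _ (Dc z Hz)) as [m Hm].
    eexists. apply Cderiv_mult; [exact Hl|]. apply Cderiv_conj. exact Hm. }
  assert (hol2 : hol_disc f2).
  { intros z Hz. destruct (hol1 z Hz) as [l Hl]. destruct (hol1 _ (Dn z Hz)) as [m Hm].
    eexists. apply Cderiv_mult; [exact Hl|].
    apply (Cderiv_comp f1 (fun z => -1 * z)%C); [|exact Hm].
    apply (Cderiv_scal _ _ (fun z => z)). apply Cderiv_id. }
  assert (holh : hol_disc h).
  { intros z Hz. destruct (hol2 z Hz) as [l Hl]. destruct (hol2 _ (Di z Hz)) as [m Hm].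
    eexists. apply Cderiv_mult; [exact Hl|].
    apply (Cderiv_comp f2 (fun z => Ci * z)%C); [|exact Hm].
    apply (Cderiv_scal _ _ (fun z => z)). apply Cderiv_id. }
  assert (hper : forall z, h (Ci * z)%C = h z).
  { intros z. unfold h, f2.
    replace (Ci * (Ci * z))%C with (-1 * z)%C
      by (destruct z; unfold Ci, Cmult; simpl; f_equal; ring).
    replace (-1 * (-1 * z))%C with z by ring. ring. }
  assert (b1 : forall z, Cmod z < 1 -> Cmod (f1 z) <= Cmod (f z) /\ Cmod (f1 z) <= Cmod (f (Cconj z))).
  { intros z Hz. unfold f1. rewrite Cmod_mult, Cmod_conj.
    generalize (Hf1 z Hz) (Hf1 _ (Dc z Hz)) (Cmod_ge_0 (f z)) (Cmod_ge_0 (f (Cconj z))). nra. }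
  assert (b1' : forall z, Cmod z < 1 -> Cmod (f1 z) <= 1).
  { intros z Hz. generalize (b1 z Hz) (Hf1 z Hz). lra. }
  assert (b2 : forall z, Cmod z < 1 -> Cmod (f2 z) <= Cmod (f1 z)).
  { intros z Hz. unfold f2. rewrite Cmod_mult.
    generalize (b1' _ (Dn z Hz)) (Cmod_ge_0 (f1 z)). nra. }
  assert (b3 : forall z, Cmod z < 1 -> Cmod (h z) <= Cmod (f1 z)).
  { intros z Hz. unfold h. rewrite Cmod_mult.
    generalize (b2 z Hz) (b2 _ (Di z Hz)) (b1' _ (Di z Hz)) (Cmod_ge_0 (f2 z)). nra. }
  set (z := fun s => (ln (Cmod (w s)), atan (snd (w s) / fst (w s)))).
  assert (Hlog : cpath z /\ forall s, cexp (z s) = w s) by (apply log_path; auto).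
  destruct Hlog as [Hz Hzw].
  assert (Hzc : cpath (fun s => Cconj (z s))).
  { apply (cpath_comp Cconj); auto. intros; apply ccont_conj. }
  assert (Hzneg : forall s, fst (z s) < 0).
  { intros s. simpl. rewrite <- ln_1. apply ln_increasing; auto.
    eapply Rlt_le_trans; [|apply fst_le_Cmod]. rewrite Rabs_right; auto.
    apply Rle_ge; left; auto. }
  assert (Econj : forall u, cexp (Cconj u) = Cconj (cexp u)).
  { intros [x y]. unfold cexp, Cconj; simpl. rewrite cos_neg, sin_neg. f_equal; ring. }
  (* An open set around both logarithmic paths, since inscribed polygons leave the paths. It depends
     on [h] and [eps] but not on the power [N], so the lengths [L1] and [L2] are fixed before
     [N]. *)
  set (W := fun u : C => fst u < 0 /\ Cmod (h (cexp u)) < eps).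
  assert (HWo : copen W).
  { intros u [Hu1 Hu2].
    destruct (Cderiv_hcexp h u holh Hu1) as [l Hl]. apply Cderiv_ccont in Hl.
    destruct (Hl (eps - Cmod (h (cexp u))) ltac:(lra)) as (d & Hd & H).
    exists (Rmin d (- fst u)). split. apply Rmin_pos; lra. intros v Hv. split.
    - assert (A1 := Rlt_le_trans _ _ _ Hv (Rmin_r _ _)).
      assert (A2 := fst_le_Cmod (v - u)). simpl in A2.
      assert (A3 : Rabs (fst v + - fst u) < - fst u) by lra. apply Rabs_def2 in A3. lra.
    - assert (A1 := H v (Rlt_le_trans _ _ _ Hv (Rmin_l _ _))). simpl in A1.
      assert (A2 := Cmod_sub_rev (h (cexp v)) (h (cexp u))). lra. }
  assert (HW1 : forall s, W (z s)).
  { intros s. split; auto. rewrite Hzw.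
    generalize (b3 _ (Hw1 s)) (proj1 (b1 _ (Hw1 s))) (Hfe s). lra. }
  assert (HW2 : forall s, W (Cconj (z s))).
  { intros s. split. simpl. apply Hzneg. rewrite Econj, Hzw.
    generalize (b3 _ (Dc _ (Hw1 s))) (proj2 (b1 _ (Dc _ (Hw1 s)))) (Hfe s).
    rewrite Cconj_conj. lra. }
  destruct (primitive_increment_bound W z HWo Hz (fun s _ => HW1 s)) as [L1 HL1].
  destruct (primitive_increment_bound W _ HWo Hzc (fun s _ => HW2 s)) as [L2 HL2].
  (* The path starts on the positive axis, so its logarithm is real there and the two paths share
     their initial point. *)
  assert (E0 : Cconj (z 0) = z 0).
  { unfold z, Cconj; simpl. rewrite Hw0. unfold Rdiv. rewrite Rmult_0_l, atan_0, Ropp_0. auto. }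
  (* On a diagonal the argument is plus or minus pi / 4, so the end point and its conjugate differ
     by exactly one quarter turn. *)
  assert (E1 : z 1 = (Cconj (z 1) + quarter)%C \/ Cconj (z 1) = (z 1 + quarter)%C).
  { assert (P1 := Hwp 1). unfold z, Cconj, quarter, Cplus; simpl.
    assert (K : snd (w 1) / fst (w 1) = 1 \/ snd (w 1) / fst (w 1) = - (1)).
    { revert Hwe. unfold Rabs. destruct Rcase_abs; intros E.
      right. apply Rmult_eq_reg_r with (fst (w 1)); [|lra]. field_simplify; lra.
      left. apply Rmult_eq_reg_r with (fst (w 1)); [|lra]. field_simplify; lra. }
    destruct K as [K|K]; rewrite K; rewrite ?atan_opp, atan_1; [left|right]; f_equal; field. }
  assert (Hh0 : Cmod (h 0) = Cmod (f 0) ^ 8).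
  { unfold h, f2, f1. rewrite !Cmult_0_r.
    assert (Ec : Cconj 0 = 0) by (unfold Cconj, RtoC; simpl; f_equal; ring).
    rewrite Ec, !Cmod_mult, !Cmod_conj. ring. }
  rewrite <- Hh0.
  apply geometric_domination with ((L1 + L2) / (PI / 2)); auto. apply Cmod_ge_0.
  intros N.
  set (hN := fun z => (h z ^ N)%C).
  assert (holN : hol_disc hN).
  { intros u Hu. destruct (holh u Hu) as [l Hl]. destruct (Cderiv_pow h u l N Hl) as [m Hm].
    exists m. exact Hm. }
  assert (perN : forall u, hN (Ci * u)%C = hN u) by (intros; unfold hN; rewrite hper; auto).
  destruct (primitive_halfplane (fun u => hN (cexp u))) as [F HF].
  { intros u Hu. apply Cderiv_hcexp; auto. }
  assert (Q := primitive_quarter_increment hN F holN perN HF).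
  assert (HB : 0 <= eps ^ N) by (apply pow_le; lra).
  assert (HFW : forall u, W u -> Cderiv F u (hN (cexp u))) by (intros u Hu; apply HF, Hu).
  assert (HGW : forall u, W u -> Cmod (hN (cexp u)) <= eps ^ N).
  { intros u [_ Hu]. unfold hN. rewrite Cmod_pow. apply pow_incr. split; [apply Cmod_ge_0|lra]. }
  assert (I1 := HL1 F (fun u => hN (cexp u)) (eps ^ N) HB HFW HGW).
  assert (I2 := HL2 F (fun u => hN (cexp u)) (eps ^ N) HB HFW HGW).
  simpl in I2. rewrite E0 in I2.
  assert (I3 : Cmod (quarter * hN 0) <= (L1 + L2) * eps ^ N).
  { destruct E1 as [E1|E1].
    - rewrite <- (Q (Cconj (z 1))) by (simpl; apply Hzneg). rewrite <- E1.
      eapply Rle_trans. apply (Cmod_triangle3 _ (F (z 0))).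
      rewrite (Cmod_sub_comm (F (z 0))). lra.
    - rewrite <- (Q (z 1)) by apply Hzneg. rewrite <- E1.
      eapply Rle_trans. apply (Cmod_triangle3 _ (F (z 0))).
      rewrite (Cmod_sub_comm (F (z 0))). lra. }
  rewrite Cmod_mult, Cmod_quarter in I3. unfold hN in I3. rewrite Cmod_pow in I3.
  assert (HPI := PI_RGT_0).
  apply Rmult_le_reg_l with (PI / 2). lra.
  eapply Rle_trans. exact I3. right. field. lra.
Qed.

(** * The crossing estimate *)

Lemma last_nonpos (u : R -> R) (a b : R) :
  continuity u -> a <= b -> u a <= 0 -> 0 < u b ->
  exists s, a <= s <= b /\ u s = 0 /\ forall t, s < t <= b -> 0 < u t.
Proof.
  intros Hu Hab Ha Hb.
  destruct (completeness (fun x => a <= x <= b /\ u x <= 0)) as [s [Hs1 Hs2]].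
  - exists b. intros x Hx; lra.
  - exists a; split; [lra|auto].
  - assert (Has : a <= s) by (apply Hs1; split; [lra|auto]).
    assert (Hsb : s <= b) by (apply Hs2; intros x Hx; lra).
    assert (Hgt : forall t, s < t <= b -> 0 < u t).
    { intros t Ht. apply Rnot_le_lt. intros Hl. assert (t <= s); [|lra].
      apply Hs1. split; [lra|auto]. }
    exists s. split; [lra|]. split; auto.
    specialize (Hu s). rewrite continuity_pt_locally in Hu.
    destruct (Rtotal_order (u s) 0) as [Hl|[E|Hg]]; auto; exfalso.
    + assert (He : 0 < - u s) by lra. destruct (Hu (mkposreal _ He)) as [d Hd]. simpl in Hd.
      assert (s <> b) by (intros ->; lra).
      set (t := Rmin b (s + d / 2)). assert (Dp := cond_pos d).
      assert (Ht : s < t <= b /\ t <= s + d / 2) by (unfold t, Rmin; destruct Rle_dec; lra).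
      assert (K : Rabs (u t - u s) < - u s) by (apply Hd; change (Rabs (t - s) < d); apply Rabs_def1; lra).
      apply Rabs_def2 in K. specialize (Hgt t ltac:(lra)). lra.
    + destruct (Hu (mkposreal _ Hg)) as [d Hd]. simpl in Hd.
      assert (s <= s - d); [|generalize (cond_pos d); lra].
      apply Hs2. intros x [Hx Hux]. apply Rnot_lt_le. intros Hl.
      assert (Hxs : x <= s) by (apply Hs1; auto).
      assert (K : Rabs (u x - u s) < u s).
      { apply Hd. generalize (cond_pos d); intros. change (Rabs (x - s) < d). apply Rabs_def1; lra. }
      apply Rabs_def2 in K. lra.
Qed.

Lemma first_nonneg (u : R -> R) (a b : R) :
  continuity u -> a <= b -> u a < 0 -> 0 <= u b ->
  exists s, a <= s <= b /\ u s = 0 /\ forall t, a <= t < s -> u t < 0.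
Proof.
  intros Hu Hab Ha Hb.
  destruct (last_nonpos (fun s => - u (- s)) (- b) (- a)) as (s & H1 & H2 & H3).
  - apply (continuity_opp (fun s => u (- s))). apply (continuity_comp Ropp u); auto.
    apply (continuity_opp (fun s => s)). apply derivable_continuous, derivable_id.
  - lra.
  - rewrite Ropp_involutive. lra.
  - rewrite Ropp_involutive. lra.
  - exists (- s). repeat split; try lra. intros t Ht.
    specialize (H3 (- t) ltac:(lra)). rewrite Ropp_involutive in H3. lra.
Qed.

(** Retraction of the line onto [0, 1]: it extends paths given on the unit interval to all of R, as
    [cpath] demands. *)
Definition clamp (t : R) : R := Rmax 0 (Rmin 1 t).

Lemma clamp_range (t : R) : 0 <= clamp t <= 1.
Proof. unfold clamp, Rmax, Rmin. repeat destruct Rle_dec; lra. Qed.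

Lemma clamp_id (t : R) : 0 <= t <= 1 -> clamp t = t.
Proof. intros. unfold clamp, Rmax, Rmin. repeat destruct Rle_dec; lra. Qed.

Lemma clamp_lip (s t : R) : Rabs (clamp s - clamp t) <= Rabs (s - t).
Proof.
  unfold clamp, Rmax, Rmin, Rabs. repeat destruct Rle_dec; repeat destruct Rcase_abs; lra.
Qed.

Lemma clamp_cont : continuity clamp.
Proof.
  intros s. apply continuity_pt_locally. intros eps. exists eps. intros u Hu.
  eapply Rle_lt_trans. apply clamp_lip. exact Hu.
Qed.

(** The path is cut between its last visit to the imaginary axis and the next visit to a diagonal.
    In between it satisfies 0 <= Re <= |Im| without meeting the real axis, so it stays in the upper
    or in the lower half plane, and a quarter turn reduces the claim to [sector_estimate]. *)
Lemma crossing_estimate (f : C -> C) (c : R -> C) (eps : R) :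
  hol_disc f -> (forall z, Cmod z < 1 -> Cmod (f z) <= 1) ->
  cpath c -> (forall s, Cmod (c s) < 1) ->
  fst (c 0) <= 0 -> Rabs (snd (c 1)) <= fst (c 1) ->
  0 < eps -> (forall s, Cmod (f (c s)) < eps) ->
  Cmod (f 0) ^ 8 <= eps.
Proof.
  intros Hf Hf1 Hc Hc1 Hc0 Hce He Hfe.
  (* A passage through the origin gives |f 0| < eps at once. Excluding it makes the imaginary part
     nonzero wherever the path meets the imaginary axis. *)
  destruct (classic (exists s, c s = 0)) as [[s Hs]|Hn].
  { specialize (Hfe s). rewrite Hs in Hfe.
    assert (H1 : Cmod (f 0) <= 1) by (apply Hf1; rewrite Cmod_0; lra).
    assert (H0 := Cmod_ge_0 (f 0)).
    assert (Cmod (f 0) ^ 7 <= 1 ^ 7) by (apply pow_incr; lra). rewrite pow1 in H.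
    change (Cmod (f 0) ^ 8) with (Cmod (f 0) * Cmod (f 0) ^ 7).
    assert (0 <= Cmod (f 0) ^ 7) by (apply pow_le; auto). nra. }
  assert (Hcc := Hc). apply cpath_components in Hcc. destruct Hcc as [Cx Cy].
  assert (Hx1 : 0 < fst (c 1)).
  { generalize (Rabs_pos (snd (c 1))); intros. destruct (Req_dec (fst (c 1)) 0) as [E|]; [|lra].
    exfalso. apply Hn. exists 1. rewrite (surjective_pairing (c 1)).
    unfold RtoC. f_equal; auto. rewrite E in Hce. 
    generalize (Rle_abs (snd (c 1))) (Rle_abs (- snd (c 1))). rewrite Rabs_Ropp. lra. }
  destruct (last_nonpos (fun s => fst (c s)) 0 1 Cx ltac:(lra) Hc0 Hx1) as (s1 & R1 & X1 & P1).
  assert (Hy1 : snd (c s1) <> 0).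
  { intros E. apply Hn. exists s1. rewrite (surjective_pairing (c s1)), X1, E. auto. }
  destruct (first_nonneg (fun s => fst (c s) - Rabs (snd (c s))) s1 1) as (s2 & R2 & X2 & P2).
  { apply (continuity_minus (fun s => fst (c s))); auto.
    apply (continuity_comp (fun s => snd (c s)) Rabs); auto. apply Rcontinuity_abs. }
  { lra. }
  { rewrite X1. apply Rabs_pos_lt in Hy1. lra. }
  { lra. }
  assert (H12 : s1 < s2).
  { destruct (Req_dec s1 s2) as [E|]; [|lra]. rewrite <- E, X1 in X2.
    apply Rabs_pos_lt in Hy1. lra. }
  assert (Hxn : forall s, s1 <= s <= s2 -> 0 <= fst (c s)).
  { intros s Hs. destruct (Req_dec s s1) as [->|]. lra. left. apply P1. lra. }
  assert (Hyn : forall s, s1 <= s <= s2 -> snd (c s) <> 0).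
  { intros s Hs E. destruct (Req_dec s s2) as [->|].
    - rewrite E, Rabs_R0 in X2. specialize (P1 s2 ltac:(lra)). lra.
    - specialize (P2 s ltac:(lra)). rewrite E, Rabs_R0 in P2. specialize (Hxn s Hs). lra. }
  assert (Hsig : exists sg, (sg = 1 \/ sg = -1) /\ forall s, s1 <= s <= s2 -> 0 < sg * snd (c s)).
  { exists (if Rlt_dec 0 (snd (c s1)) then 1 else -1).
    set (sg := if Rlt_dec 0 (snd (c s1)) then 1 else -1).
    split. unfold sg; destruct Rlt_dec; auto.
    assert (H0 : 0 < sg * snd (c s1)) by (unfold sg; destruct Rlt_dec; lra).
    intros s Hs. apply Rnot_le_lt. intros Hl.
    destruct (first_nonneg (fun s => - sg * snd (c s)) s1 s) as (t & Ht & E & _); try lra.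
    - apply (continuity_scal (fun s => snd (c s)) (- sg)); auto.
    - apply (Hyn t ltac:(lra)). unfold sg in E. destruct Rlt_dec; lra. }
  destruct Hsig as (sg & Hsg & Hsy).
  set (k := fun t => s1 + clamp t * (s2 - s1)).
  assert (Hk : forall t, s1 <= k t <= s2).
  { intros t. unfold k. generalize (clamp_range t); intros. nra. }
  assert (Ck : continuity k).
  { apply (continuity_plus (fun _ => s1) (fun t => clamp t * (s2 - s1))).
    apply continuity_const. intros x y; auto.
    apply (continuity_mult clamp (fun _ => s2 - s1)). apply clamp_cont.
    apply continuity_const. intros x y; auto. }
  assert (K0 : k 0 = s1) by (unfold k; rewrite clamp_id by lra; ring).
  assert (K1 : k 1 = s2) by (unfold k; rewrite clamp_id by lra; ring).
  (* [m] is the turn by -i or i, according to the sign of the imaginary part, and [m'] is its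
     inverse. Precomposing [f] with [m'] keeps the value at 0. *)
  set (m := (0, - sg) : C). set (m' := (0, sg) : C).
  assert (Em : forall z, (m' * (m * z))%C = z).
  { intros [x y]. unfold m, m', Cmult; simpl. destruct Hsg as [-> | ->]; f_equal; ring. }
  assert (Mm : Cmod m = 1 /\ Cmod m' = 1).
  { unfold m, m', Cmod; simpl. destruct Hsg as [-> | ->]; split;
    match goal with |- sqrt ?a = 1 => replace a with 1 by ring end; apply sqrt_1. }
  destruct Mm as [Mm Mm'].
  assert (Em0 : (m' * 0)%C = 0) by ring.
  rewrite <- Em0.
  apply (sector_estimate (fun z => f (m' * z)%C) (fun t => m * c (k t))%C eps).
  - intros z Hz. destruct (Hf (m' * z)%C) as [l Hl]. rewrite Cmod_mult, Mm'; lra.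
    eexists. apply (Cderiv_comp f (fun z => m' * z)%C); [|exact Hl].
    apply (Cderiv_scal _ _ (fun z => z)). apply Cderiv_id.
  - intros z Hz. apply Hf1. rewrite Cmod_mult, Mm'; lra.
  - apply (cpath_comp (fun z => m * z)%C (fun t => c (k t))).
    apply cpath_reparam; auto. intros s. apply ccont_mult. apply ccont_const. apply ccont_id.
  - intros s. rewrite Cmod_mult, Mm. specialize (Hc1 (k s)). lra.
  - intros s. simpl. specialize (Hsy (k s) (Hk s)). lra.
  - simpl. rewrite K0, X1. ring.
  - simpl. rewrite K1. specialize (Hsy s2 ltac:(lra)). specialize (Hxn s2 ltac:(lra)).
    destruct Hsg as [-> | ->].
    + rewrite Rabs_right in X2 by lra. replace (0 * _ + _) with (- fst (c s2)) by ring.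
      rewrite Rabs_Ropp, Rabs_right; lra.
    + rewrite Rabs_left in X2 by lra. replace (0 * snd _ + _) with (fst (c s2)) by ring.
      rewrite Rabs_right; lra.
  - auto.
  - intros s. rewrite Em. auto.
Qed.

(** * Disc automorphisms with a real parameter *)

Definition mobius (r : R) (z : C) : C := ((z + r) / (1 + r * z))%C.

Lemma mobius_den (r : R) (z : C) : -1 < r < 1 -> Cmod z < 1 -> (1 + r * z)%C <> 0.
Proof.
  intros Hr Hz E. assert (H := Cmod_sub_rev 1 (- (r * z))).
  replace (1 - - (r * z))%C with (1 + r * z)%C in H by ring.
  rewrite E, Cmod_0, Cmod_1, Cmod_opp, Cmod_mult, Cmod_R in H.
  assert (Rabs r < 1) by (apply Rabs_def1; lra).
  generalize (Cmod_ge_0 z) (Rabs_pos r). nra.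
Qed.

Lemma Cmod_sqr (z : C) : Cmod z ^ 2 = fst z ^ 2 + snd z ^ 2.
Proof. apply pow2_sqrt. nra. Qed.

Lemma Cmod_lt1_sqr (z : C) : Cmod z < 1 <-> fst z ^ 2 + snd z ^ 2 < 1.
Proof. rewrite <- Cmod_sqr. generalize (Cmod_ge_0 z). split; nra. Qed.

Lemma mobius_disc (r : R) (z : C) : -1 < r < 1 -> Cmod z < 1 -> Cmod (mobius r z) < 1.
Proof.
  intros Hr Hz. assert (Hd := mobius_den r z Hr Hz). unfold mobius. rewrite Cmod_div by auto.
  apply Cmod_gt_0 in Hd. apply Rmult_lt_reg_r with (Cmod (1 + r * z)); auto.
  unfold Rdiv. rewrite Rmult_assoc, Rinv_l, Rmult_1_l, Rmult_1_r by lra.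
  apply Cmod_lt1_sqr in Hz. apply Rsqr_incrst_0; try apply Cmod_ge_0.
  unfold Rsqr. replace (Cmod (z + r) * Cmod (z + r)) with (Cmod (z + r) ^ 2) by ring.
  replace (Cmod (1 + r * z) * Cmod (1 + r * z)) with (Cmod (1 + r * z) ^ 2) by ring.
  rewrite !Cmod_sqr. destruct z as [x y]. simpl in *.
  (* This product is |1 + r z|^2 - |z + r|^2. *)
  assert (0 < (1 - r * r) * (1 - (x * x + y * y))) by (apply Rmult_lt_0_compat; nra). nra.
Qed.

Lemma mobius_inv (r : R) (z : C) : -1 < r < 1 -> Cmod z < 1 -> mobius r (mobius (- r) z) = z.
Proof.
  intros Hr Hz. assert (H1 := mobius_den (- r) z ltac:(lra) Hz).
  assert (H2 := mobius_den r (mobius (- r) z) Hr (mobius_disc (- r) z ltac:(lra) Hz)).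
  unfold mobius in *. rewrite RtoC_opp in *.
  assert (H3 : (1 - r * r)%C <> 0).
  { rewrite <- RtoC_mult, <- RtoC_minus. intros E. apply RtoC_inj in E. nra. }
  field. split; auto.
  intros E. apply H3. rewrite <- E. ring.
Qed.

(** The difference quotient of [mobius r] is exactly (1 - r^2) / ((1 + r z)(1 + r w)), so the
    continuous slope can be written down. *)
Lemma Cderiv_mobius (r : R) (z : C) :
  -1 < r < 1 -> Cmod z < 1 -> exists l, Cderiv (mobius r) z l.
Proof.
  intros Hr Hz. assert (Hd := mobius_den r z Hr Hz).
  exists ((1 - r * r) / (1 + r * z) * / (1 + r * z))%C.
  exists (fun w => (1 - r * r) / (1 + r * z) * / (1 + r * w))%C. split; [auto|split].
  - apply (ccont_mult (fun _ => (1 - r * r) / (1 + r * z))%C). apply ccont_const.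
    apply (ccont_comp Cinv (fun w => 1 + r * w)%C). 2: apply ccont_inv; auto.
    apply (ccont_plus (fun _ => RtoC 1) (fun w => r * w)%C). apply ccont_const.
    apply ccont_mult. apply ccont_const. apply ccont_id.
  - exists (1 - Cmod z). split. lra. intros w Hw.
    assert (Hw1 : Cmod w < 1) by (generalize (Cmod_sub_rev w z); lra).
    assert (Hdw := mobius_den r w Hr Hw1). unfold mobius. field. auto.
Qed.

(** [D] is the inverse of |1 - r z|^2 and comes from multiplying by the conjugate denominator. The
    half plane and the sector are insensitive to this positive factor, so both become polynomial
    conditions on [z]. *)
Lemma mobius_components (r : R) (z : C) :
  -1 < r < 1 -> Cmod z < 1 -> exists D, 0 < D /\
    fst (mobius (- r) z) = D * (fst z * (1 + r * r) - r * (1 + Cmod z ^ 2)) /\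
    snd (mobius (- r) z) = D * (snd z * (1 - r * r)).
Proof.
  intros Hr Hz. assert (Hd := mobius_den (- r) z ltac:(lra) Hz).
  apply Cmod_gt_0 in Hd.
  assert (Hd2 : 0 < Cmod (1 + (- r)%R * z) ^ 2) by nra. rewrite Cmod_sqr in *.
  exists (/ (fst (1 + (- r)%R * z)%C ^ 2 + snd (1 + (- r)%R * z)%C ^ 2)).
  split. apply Rinv_0_lt_compat; auto.
  destruct z as [x y]. unfold mobius, Cdiv, Cinv, Cmult, Cplus, RtoC in *; simpl in *.
  split; field; nra.
Qed.

(** The inequalities on [c 0] and [c 1] say that [mobius (- r)] sends these points into the half
    plane Re <= 0 and into the sector. The origin in [crossing_estimate] then corresponds to the
    point [r]. *)
Lemma crossing_estimate_mobius (f : C -> C) (c : R -> C) (r eps : R) :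
  hol_disc f -> (forall z, Cmod z < 1 -> Cmod (f z) <= 1) -> -1 < r < 1 ->
  cpath c -> (forall s, Cmod (c s) < 1) ->
  fst (c 0) * (1 + r * r) - r * (1 + Cmod (c 0) ^ 2) <= 0 ->
  Rabs (snd (c 1)) * (1 - r * r) <= fst (c 1) * (1 + r * r) - r * (1 + Cmod (c 1) ^ 2) ->
  0 < eps -> (forall s, Cmod (f (c s)) < eps) ->
  Cmod (f r) ^ 8 <= eps.
Proof.
  intros Hf Hf1 Hr Hc Hc1 H0 H1 He Hfe.
  assert (E0 : mobius r 0 = r) by (unfold mobius; field; intros E; apply RtoC_inj in E; lra).
  rewrite <- E0.
  apply (crossing_estimate (fun z => f (mobius r z)) (fun s => mobius (- r) (c s)) eps).
  - intros z Hz. destruct (Cderiv_mobius r z Hr Hz) as [m Hm].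
    destruct (Hf _ (mobius_disc r z Hr Hz)) as [l Hl].
    eexists. apply (Cderiv_comp f (mobius r)); eauto.
  - intros z Hz. apply Hf1. apply mobius_disc; auto.
  - apply cpath_comp; auto. intros s. destruct (Cderiv_mobius (- r) (c s)) as [m Hm]; auto. lra.
    eapply Cderiv_ccont; eauto.
  - intros s. apply mobius_disc; auto. lra.
  - destruct (mobius_components r (c 0) Hr (Hc1 0)) as (D & HD & E1 & _). rewrite E1. nra.
  - destruct (mobius_components r (c 1) Hr (Hc1 1)) as (D & HD & E1 & E2). rewrite E1, E2.
    rewrite !Rabs_mult, (Rabs_right D), (Rabs_right (1 - r * r)) by nra.
    apply Rmult_le_compat_l; lra.
  - auto.
  - intros s. rewrite mobius_inv; auto.
Qed.

(** * Lifting paths and homotopies to a covering *)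

Lemma Cnorm_Cmod (z : C) : Cnorm z = Cmod z.
Proof. unfold Cnorm, Cmod. f_equal. ring. Qed.

Lemma Cdist_Cmod (z w : C) : Cdist z w = Cmod (z - w).
Proof. unfold Cdist. rewrite Cnorm_Cmod. reflexivity. Qed.

(** Sheets and inverse branches are carried as data, so that a branch for each sheet is chosen once,
    in [covering_evenly_covered]. As [V] is open, relative continuity on [V] becomes [ccont]. *)
Definition evenly_covered (phi : C -> C) (V : C -> Prop) (I : Type) (U : I -> C -> Prop)
    (g : I -> C -> C) : Prop :=
  copen V /\ (forall i, copen (U i)) /\ (forall i z, U i z -> Cmod z < 1) /\
  (forall i j z, U i z -> U j z -> i = j) /\
  (forall z, Cmod z < 1 -> V (phi z) -> exists i, U i z) /\
  (forall i v, V v -> U i (g i v) /\ phi (g i v) = v) /\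
  (forall i u, U i u -> g i (phi u) = u) /\
  (forall i v, V v -> ccont (g i) v).

Lemma covering_evenly_covered (phi : C -> C) (Om : C -> Prop) (w : C) :
  covering_map phi Om -> Om w ->
  exists V I U g, V w /\ @evenly_covered phi V I U g.
Proof.
  intros (_ & _ & _ & Hc) Hw.
  destruct (Hc w Hw) as (V & HV & HVw & _ & I & U & H1 & H2 & H3 & H4).
  assert (HV' : copen V).
  { intros z Hz. destruct (HV z Hz) as (r & Hr & H). exists r. split; auto.
    intros u Hu. apply H. rewrite Cdist_Cmod. auto. }
  set (g := fun i => proj1_sig (constructive_indefinite_description _ (H4 i))).
  exists V, I, U, g. split; auto.
  assert (Hg : forall i, (forall v, V v -> U i (g i v) /\ phi (g i v) = v) /\
          (forall u, U i u -> g i (phi u) = u) /\ Ccontinuous_on V (g i)).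
  { intros i. unfold g. destruct constructive_indefinite_description; simpl; auto. }
  repeat split.
  - auto.
  - intros i z Hz. destruct (proj1 (H1 i) z Hz) as (r & Hr & H). exists r. split; auto.
    intros u Hu. apply H. rewrite Cdist_Cmod. auto.
  - intros i z Hz. rewrite <- Cnorm_Cmod. apply (proj2 (H1 i)); auto.
  - auto.
  - intros z Hz Hv. apply H3; auto. unfold Disc. rewrite Cnorm_Cmod; auto.
  - apply (Hg i); auto.
  - apply (Hg i); auto.
  - intros i u Hu. apply (Hg i); auto.
  - intros i v Hv e He. destruct (HV' v Hv) as (r & Hr & Hb).
    destruct (proj2 (proj2 (Hg i)) v Hv e He) as (d & Hd & H).
    exists (Rmin d r). split. apply Rmin_pos; auto. intros u Hu.
    rewrite <- Cdist_Cmod. apply H. apply Hb. eapply Rlt_le_trans; [exact Hu|apply Rmin_r].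
    rewrite Cdist_Cmod. eapply Rlt_le_trans; [exact Hu|apply Rmin_l].
Qed.

Lemma covering_image (phi : C -> C) (Om : C -> Prop) (z : C) :
  covering_map phi Om -> Cmod z < 1 -> Om (phi z).
Proof. intros (_ & H & _) Hz. apply H. unfold Disc. rewrite Cnorm_Cmod; auto. Qed.

Lemma covering_ccont (phi : C -> C) (Om : C -> Prop) (z : C) :
  covering_map phi Om -> Cmod z < 1 -> ccont phi z.
Proof.
  intros (H & _) Hz e He. assert (HD : Disc z) by (unfold Disc; rewrite Cnorm_Cmod; auto).
  destruct (H z HD e He) as (d & Hd & K). exists (Rmin d (1 - Cmod z)).
  split. apply Rmin_pos; lra. intros w Hw. rewrite <- Cdist_Cmod. apply K.
  - unfold Disc. rewrite Cnorm_Cmod.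
    assert (A := Rlt_le_trans _ _ _ Hw (Rmin_r _ _)). generalize (Cmod_sub_rev w z). lra.
  - rewrite Cdist_Cmod. eapply Rlt_le_trans; [exact Hw|apply Rmin_l].
Qed.

Definition cont_on (J : R -> Prop) (c : R -> C) : Prop :=
  forall s, J s -> forall eps, 0 < eps -> exists d, 0 < d /\
    forall s', J s' -> Rabs (s' - s) < d -> Cmod (c s' - c s) < eps.

Definition interval (J : R -> Prop) : Prop :=
  forall x y t, J x -> J y -> x <= t <= y -> J t.

Definition lift_on (phi : C -> C) (J : R -> Prop) (c ch : R -> C) : Prop :=
  cont_on J ch /\ forall s, J s -> Cmod (ch s) < 1 /\ phi (ch s) = c s.

Lemma cont_on_open (J : R -> Prop) (c : R -> C) (W : C -> Prop) (s : R) :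
  cont_on J c -> copen W -> J s -> W (c s) ->
  exists d, 0 < d /\ forall t, J t -> Rabs (t - s) < d -> W (c t).
Proof.
  intros Hc HW Hs Hw. destruct (HW _ Hw) as (r & Hr & H).
  destruct (Hc s Hs r Hr) as (d & Hd & K). exists d. auto.
Qed.

Lemma cont_on_sub (J J' : R -> Prop) (c : R -> C) :
  (forall s, J' s -> J s) -> cont_on J c -> cont_on J' c.
Proof.
  intros Hs Hc s Hj e He. destruct (Hc s (Hs s Hj) e He) as (d & Hd & K). exists d. auto.
Qed.

(** Near each parameter the lifts stay in sheets [U i] and [U j]. Agreement at one nearby parameter
    forces [i = j], and then both lifts are [g i] composed with [c]. [J] is an arbitrary interval
    because [convex_lift] uses relatively open pieces of [seg 0 1]. *)
Lemma lift_unique (phi : C -> C) (Om : C -> Prop) (J : R -> Prop) (c c1 c2 : R -> C) (x y : R) :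
  covering_map phi Om -> interval J -> lift_on phi J c c1 -> lift_on phi J c c2 ->
  J x -> J y -> c1 x = c2 x -> c1 y = c2 y.
Proof.
  intros Hcov HJ [C1 L1] [C2 L2] Hx Hy E.
  assert (Loc : forall s, J s -> exists d, 0 < d /\ forall u v, J u -> J v ->
     Rabs (u - s) < d -> Rabs (v - s) < d -> c1 u = c2 u -> c1 v = c2 v).
  { intros s Hs. destruct (L1 s Hs) as [D1 E1]. destruct (L2 s Hs) as [D2 E2].
    assert (HO := covering_image phi Om _ Hcov D1).
    destruct (covering_evenly_covered phi Om _ Hcov HO)
      as (V & I & U & g & HV & (_ & HU & HUD & Hdis & Hsh & Hg & Hg' & _)).
    destruct (Hsh _ D1 HV) as [i Hi].
    assert (HV2 : V (phi (c2 s))) by (rewrite E2, <- E1; auto).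
    destruct (Hsh _ D2 HV2) as [j Hj].
    destruct (cont_on_open J c1 (U i) s C1 (HU i) Hs Hi) as (d1 & P1 & K1).
    destruct (cont_on_open J c2 (U j) s C2 (HU j) Hs Hj) as (d2 & P2 & K2).
    exists (Rmin d1 d2). split. apply Rmin_pos; auto. intros u v Hu Hv Hus Hvs Euv.
    assert (Ui := K1 u Hu (Rlt_le_trans _ _ _ Hus (Rmin_l _ _))).
    assert (Uj := K2 u Hu (Rlt_le_trans _ _ _ Hus (Rmin_r _ _))).
    rewrite <- Euv in Uj. assert (i = j) by (eapply Hdis; eauto). subst j.
    rewrite <- (Hg' i (c1 v)) by (apply K1; auto; eapply Rlt_le_trans; [exact Hvs|apply Rmin_l]).
    rewrite <- (Hg' i (c2 v)) by (apply K2; auto; eapply Rlt_le_trans; [exact Hvs|apply Rmin_r]).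
    f_equal. rewrite (proj2 (L1 v Hv)), (proj2 (L2 v Hv)). auto. }
  destruct (Rle_dec x y) as [Hxy|Hxy].
  - apply (interval_ind (fun s => c1 s = c2 s) x y); auto.
    intros s Hs. destruct (Loc s (HJ x y s Hx Hy Hs)) as (d & Hd & K). exists d. split; auto.
    intros u v Hu Hv. apply K; apply (HJ x y); auto.
  (* For [y < x] the contrapositive is run: disagreement would spread forwards from [y] to [x]. *)
  - apply NNPP. intros Hne. 
    apply (interval_ind (fun s => c1 s <> c2 s) y x); auto. lra.
    intros s Hs. destruct (Loc s (HJ y x s Hy Hx Hs)) as (d & Hd & K). exists d. split; auto.
    intros u v Hu Hv Hus Hvs N E'. apply N. apply (K v u); auto; apply (HJ y x); auto.
Qed.

Definition seg (a b s : R) : Prop := a <= s <= b.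

Lemma interval_seg (a b : R) : interval (seg a b).
Proof. intros x y t. unfold seg. lra. Qed.

Lemma cont_on_glue (a x b : R) (c1 c2 : R -> C) :
  cont_on (seg a x) c1 -> cont_on (seg x b) c2 -> c1 x = c2 x ->
  cont_on (seg a b) (fun t => if Rle_dec t x then c1 t else c2 t).
Proof.
  unfold seg. intros H1 H2 E s Hs e He.
  destruct (Rtotal_order s x) as [Hl|[Heq|Hg]].
  - destruct (H1 s ltac:(lra) e He) as (d & Hd & K).
    exists (Rmin d (x - s)). split. apply Rmin_pos; lra. intros t Ht Hts.
    assert (A1 := Rlt_le_trans _ _ _ Hts (Rmin_l _ _)).
    assert (A2 := Rlt_le_trans _ _ _ Hts (Rmin_r _ _)). apply Rabs_def2 in A2.
    destruct Rle_dec; [|lra]. destruct Rle_dec; [|lra]. apply K; auto. lra.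
  - subst s. destruct (Rle_dec x x) as [_|]; [|lra].
    assert (A : exists d, 0 < d /\ forall t, a <= t <= x -> Rabs (t - x) < d -> Cmod (c1 t - c1 x) < e).
    { destruct (Rle_dec a x).
      - destruct (H1 x ltac:(lra) e He) as (d & Hd & K). exists d. auto.
      - exists 1. split. lra. intros; lra. }
    assert (B : exists d, 0 < d /\ forall t, x <= t <= b -> Rabs (t - x) < d -> Cmod (c2 t - c1 x) < e).
    { destruct (Rle_dec x b).
      - destruct (H2 x ltac:(lra) e He) as (d & Hd & K). exists d. rewrite E. auto.
      - exists 1. split. lra. intros; lra. }
    destruct A as (d1 & P1 & K1). destruct B as (d2 & P2 & K2).
    exists (Rmin d1 d2). split. apply Rmin_pos; auto. intros t Ht Htx.
    assert (A1 := Rlt_le_trans _ _ _ Htx (Rmin_l _ _)).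
    assert (A2 := Rlt_le_trans _ _ _ Htx (Rmin_r _ _)).
    destruct Rle_dec. apply K1; auto; lra. apply K2; auto; lra.
  - destruct (H2 s ltac:(lra) e He) as (d & Hd & K).
    exists (Rmin d (s - x)). split. apply Rmin_pos; lra. intros t Ht Hts.
    assert (A1 := Rlt_le_trans _ _ _ Hts (Rmin_l _ _)).
    assert (A2 := Rlt_le_trans _ _ _ Hts (Rmin_r _ _)). apply Rabs_def2 in A2.
    destruct Rle_dec; [lra|]. destruct Rle_dec; [lra|]. apply K; auto. lra.
Qed.

Lemma cont_on_comp (J : R -> Prop) (c : R -> C) (g : C -> C) :
  cont_on J c -> (forall s, J s -> ccont g (c s)) -> cont_on J (fun s => g (c s)).
Proof.
  intros Hc Hg s Hs e He. destruct (Hg s Hs e He) as (d & Hd & K).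
  destruct (Hc s Hs d Hd) as (d' & Hd' & K'). exists d'. auto.
Qed.

(** A lift on [seg 0 x] is continued by the inverse branch on the sheet that contains [ch x]; the
    pieces match at [x] because [g i] inverts [phi] on that sheet. *)
Lemma path_lift (phi : C -> C) (Om : C -> Prop) (c : R -> C) (zh : C) :
  covering_map phi Om -> cont_on (seg 0 1) c -> (forall s, seg 0 1 s -> Om (c s)) ->
  Cmod zh < 1 -> phi zh = c 0 ->
  exists ch, lift_on phi (seg 0 1) c ch /\ ch 0 = zh.
Proof.
  intros Hcov Hc HO Hz Ez.
  apply (interval_ind (fun s => exists ch, lift_on phi (seg 0 s) c ch /\ ch 0 = zh) 0 1).
  - lra.
  - exists (fun _ => zh). split; auto. split.
    + intros s _ e He. exists 1. split. lra. intros. rewrite Cmod_sub_diag. auto.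
    + intros s Hs. assert (s = 0) as -> by (unfold seg in Hs; lra). auto.
  - intros s Hs.
    destruct (covering_evenly_covered phi Om _ Hcov (HO s Hs))
      as (V & I & U & g & HV & (HVo & HU & HUD & Hdis & Hsh & Hg & Hg' & Hgc)).
    destruct (cont_on_open _ c V s Hc HVo Hs HV) as (d & Hd & K).
    exists d. split; auto. intros x y Hx Hy Hxs Hys (ch & [Cch Lch] & E0).
    destruct (Rle_dec y x) as [Hyx|Hyx].
    { exists ch. split; auto. split.
      - apply cont_on_sub with (seg 0 x); auto. unfold seg; intros; lra.
      - intros t Ht. apply Lch. unfold seg in *; lra. }
    assert (Wn : forall t, seg x y t -> V (c t)).
    { intros t Ht. unfold seg in *. apply K. lra.
      apply Rabs_def2 in Hxs. apply Rabs_def2 in Hys. apply Rabs_def1; lra. }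
    destruct (Lch x ltac:(unfold seg; lra)) as [Dx Ex].
    assert (HVx : V (phi (ch x))) by (rewrite Ex; apply Wn; unfold seg; lra).
    destruct (Hsh _ Dx HVx) as [i Hi].
    exists (fun t => if Rle_dec t x then ch t else g i (c t)). split; [split|].
    + apply (cont_on_glue 0 x y ch (fun t => g i (c t))); auto.
      * apply cont_on_comp.
        apply cont_on_sub with (seg 0 1); auto. unfold seg; intros; lra.
        intros t Ht. auto.
      * rewrite <- Ex, Hg'; auto.
    + intros t Ht. unfold seg in Ht. destruct Rle_dec.
      * apply Lch. unfold seg; lra.
      * destruct (Hg i (c t)) as [A1 A2]. apply Wn. unfold seg; lra. split; auto.
        eapply HUD; eauto.
    + destruct Rle_dec; auto. lra.
Qed.

(** * Lifting maps of two parameters on convex domains *)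

Definition cont_on2 (E : R -> R -> Prop) (h : R -> R -> C) : Prop :=
  forall s t, E s t -> forall eps, 0 < eps -> exists d, 0 < d /\
    forall s' t', E s' t' -> Rabs (s' - s) < d -> Rabs (t' - t) < d ->
      Cmod (h s' t' - h s t) < eps.

Definition convex2 (E : R -> R -> Prop) : Prop :=
  forall s t s' t' k, E s t -> E s' t' -> 0 <= k <= 1 ->
    E (s + k * (s' - s)) (t + k * (t' - t)).

Definition lift_on2 (phi : C -> C) (E : R -> R -> Prop) (h L : R -> R -> C) : Prop :=
  cont_on2 E L /\ forall s t, E s t -> Cmod (L s t) < 1 /\ phi (L s t) = h s t.

Lemma affine_close (a s s' k k' d : R) :
  0 <= k' <= 1 -> Rabs (s' - s) < d / 2 -> Rabs (k' - k) < d / 2 / (1 + Rabs (s - a)) ->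
  Rabs ((a + k' * (s' - a)) - (a + k * (s - a))) < d.
Proof.
  intros Hk Hs Hkk. assert (P := Rabs_pos (s - a)).
  replace (a + k' * (s' - a) - (a + k * (s - a))) with (k' * (s' - s) + (k' - k) * (s - a)) by ring.
  eapply Rle_lt_trans. apply Rabs_triang. rewrite !Rabs_mult, (Rabs_right k') by lra.
  assert (P1 := Rabs_pos (s' - s)).
  assert (A : Rabs (k' - k) * (1 + Rabs (s - a)) < d / 2).
  { apply Rmult_lt_reg_r with (/ (1 + Rabs (s - a))). apply Rinv_0_lt_compat; lra.
    rewrite Rmult_assoc, Rinv_r by lra. unfold Rdiv in *. lra. }
  assert (P2 := Rabs_pos (k' - k)). nra.
Qed.

Lemma cont_on2_segment (E : R -> R -> Prop) (h : R -> R -> C) (a b s t k : R) :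
  convex2 E -> cont_on2 E h -> E a b -> E s t -> 0 <= k <= 1 ->
  forall eps, 0 < eps -> exists d, 0 < d /\ forall s' t' k', E s' t' -> 0 <= k' <= 1 ->
    Rabs (s' - s) < d -> Rabs (t' - t) < d -> Rabs (k' - k) < d ->
    Cmod (h (a + k' * (s' - a)) (b + k' * (t' - b))
          - h (a + k * (s - a)) (b + k * (t - b))) < eps.
Proof.
  intros HE Hh Hab Hst Hk e He.
  destruct (Hh _ _ (HE a b s t k Hab Hst Hk) e He) as (d & Hd & K).
  assert (P1 := Rabs_pos (s - a)). assert (P2 := Rabs_pos (t - b)).
  set (d1 := d / 2 / (1 + Rabs (s - a))). set (d2 := d / 2 / (1 + Rabs (t - b))).
  assert (H1 : 0 < d1) by (apply Rdiv_lt_0_compat; lra).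
  assert (H2 : 0 < d2) by (apply Rdiv_lt_0_compat; lra).
  exists (Rmin (d / 2) (Rmin d1 d2)). split. repeat apply Rmin_pos; lra.
  intros s' t' k' Hst' Hk' As At Ak.
  assert (M1 := Rmin_l (d / 2) (Rmin d1 d2)). assert (M2 := Rmin_r (d / 2) (Rmin d1 d2)).
  assert (M3 := Rmin_l d1 d2). assert (M4 := Rmin_r d1 d2).
  apply K.
  - apply HE; auto.
  - apply affine_close; auto. lra. fold d1. lra.
  - apply affine_close; auto. lra. fold d2. lra.
Qed.

Lemma cont_on2_path (E : R -> R -> Prop) (h : R -> R -> C) (a b s t : R) :
  convex2 E -> cont_on2 E h -> E a b -> E s t ->
  cont_on (seg 0 1) (fun k => h (a + k * (s - a)) (b + k * (t - b))).
Proof.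
  intros HE Hh Hab Hst k Hk e He.
  destruct (cont_on2_segment E h a b s t k HE Hh Hab Hst Hk e He) as (d & Hd & K).
  exists d. split; auto. intros k' Hk' Ak. apply K; auto; rewrite Rminus_diag, Rabs_R0; auto.
Qed.

Lemma lift_on2_unique (phi : C -> C) (Om : C -> Prop) (E : R -> R -> Prop)
    (h L1 L2 : R -> R -> C) (a b s t : R) :
  covering_map phi Om -> convex2 E -> lift_on2 phi E h L1 -> lift_on2 phi E h L2 ->
  E a b -> E s t -> L1 a b = L2 a b -> L1 s t = L2 s t.
Proof.
  intros Hcov HE [C1 H1] [C2 H2] Hab Hst E0.
  assert (K := lift_unique phi Om (seg 0 1)
    (fun k => h (a + k * (s - a)) (b + k * (t - b)))
    (fun k => L1 (a + k * (s - a)) (b + k * (t - b)))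
    (fun k => L2 (a + k * (s - a)) (b + k * (t - b))) 0 1 Hcov (interval_seg 0 1)).
  simpl in K.
  replace (a + 0 * (s - a)) with a in K by ring. replace (b + 0 * (t - b)) with b in K by ring.
  replace (a + 1 * (s - a)) with s in K by ring. replace (b + 1 * (t - b)) with t in K by ring.
  apply K; auto; try (unfold seg; lra).
  - split. apply cont_on2_path with E; auto. intros k Hk. apply H1. apply HE; auto.
  - split. apply cont_on2_path with E; auto. intros k Hk. apply H2. apply HE; auto.
Qed.

(* The lift at [(s, t)] is the end point of the lift of the segment from [(a, b)] to [(s, t)]. *)
Lemma convex_lift (phi : C -> C) (Om : C -> Prop) (E : R -> R -> Prop) (h : R -> R -> C)
    (a b : R) (zh : C) :
  covering_map phi Om -> convex2 E -> cont_on2 E h -> (forall s t, E s t -> Om (h s t)) ->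
  E a b -> Cmod zh < 1 -> phi zh = h a b ->
  exists L, lift_on2 phi E h L /\ L a b = zh.
Proof.
  intros Hcov HE Hh HO Hab Hz Ez.
  set (K := fun s t k => h (a + k * (s - a)) (b + k * (t - b))).
  assert (EK : forall s t k, E s t -> seg 0 1 k -> E (a + k * (s - a)) (b + k * (t - b))).
  { intros. apply HE; auto. }
  assert (K0 : forall s t, K s t 0 = h a b) by (intros; unfold K; f_equal; ring).
  assert (K1 : forall s t, K s t 1 = h s t) by (intros; unfold K; f_equal; ring).
  assert (KC : forall s t, E s t -> cont_on (seg 0 1) (K s t)).
  { intros s t Hst. apply cont_on2_path with E; auto. }
  assert (Ex : forall s t, exists ch, E s t -> lift_on phi (seg 0 1) (K s t) ch /\ ch 0 = zh).
  { intros s t. destruct (classic (E s t)) as [Hst|Hst].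
    - destruct (path_lift phi Om (K s t) zh) as [ch Hch]; auto.
      + intros k Hk. apply HO, EK; auto.
      + rewrite K0; auto.
      + exists ch; auto.
    - exists (fun _ => zh). tauto. }
  set (l := fun s t => proj1_sig (constructive_indefinite_description _ (Ex s t))).
  assert (Hl : forall s t, E s t -> lift_on phi (seg 0 1) (K s t) (l s t) /\ l s t 0 = zh).
  { intros s t. unfold l. destruct constructive_indefinite_description; simpl; auto. }
  clearbody l.
  assert (S0 : seg 0 1 0) by (unfold seg; lra). assert (S1 : seg 0 1 1) by (unfold seg; lra).
  exists (fun s t => l s t 1). split; [split|].
  - intros s t Hst.
    (* Continuity in [(s, t)] is propagated along the segments: it is shown for the lifts at time
       [k], starting from [k = 0], where all of them equal [zh]. *)
    apply (interval_ind (fun k => forall eps, 0 < eps -> exists d, 0 < d /\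
      forall s' t', E s' t' -> Rabs (s' - s) < d -> Rabs (t' - t) < d ->
      Cmod (l s' t' k - l s t k) < eps) 0 1); [lra| |].
    { intros e He. exists 1. split. lra. intros s' t' Hst' _ _.
      rewrite (proj2 (Hl s t Hst)), (proj2 (Hl s' t' Hst')), Cmod_sub_diag. auto. }
    intros k Hk.
    destruct (covering_evenly_covered phi Om _ Hcov (HO _ _ (EK s t k Hst Hk)))
      as (V & I & U & g & HV & (HVo & HU & HUD & Hdis & Hsh & Hg & Hg' & Hgc)).
    destruct (HVo _ HV) as (r & Hr & HVr).
    destruct (cont_on2_segment E h a b s t k HE Hh Hab Hst Hk r Hr) as (d & Hd & HK).
    exists d. split; auto. intros x y Hx Hy Ax Ay Px e He.
    assert (HKV : forall s' t' k', E s' t' -> seg 0 1 k' -> Rabs (s' - s) < d ->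
       Rabs (t' - t) < d -> Rabs (k' - k) < d -> V (K s' t' k')).
    { intros. apply HVr. apply HK; auto. }
    assert (Z : forall u, Rabs (u - u) < d) by (intros; rewrite Rminus_diag, Rabs_R0; auto).
    destruct (Hl s t Hst) as [[_ Hlx] _]. destruct (Hlx x Hx) as [Dx Ekx].
    assert (HVx : V (phi (l s t x))) by (rewrite Ekx; apply HKV; auto).
    destruct (Hsh _ Dx HVx) as [i Hi].
    destruct (HU i _ Hi) as (rho & Hrho & HUr).
    destruct (Px rho Hrho) as (d2 & Hd2 & HPx).
    (* Neighbouring lifts that are at time [x] in the sheet of [l s t x] are all given at time [y]
       by the one branch [g i], hence depend continuously on [(s, t)]. *)
    assert (Form : forall s' t', E s' t' -> Rabs (s' - s) < d -> Rabs (t' - t) < d ->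
       U i (l s' t' x) -> l s' t' y = g i (K s' t' y)).
    { intros s' t' Hst' As At HUx.
      set (J := fun u => seg 0 1 u /\ Rabs (u - k) < d).
      apply (lift_unique phi Om J (K s' t') (l s' t') (fun u => g i (K s' t' u)) x y Hcov).
      - intros u v w [U1 U2] [V1 V2] W. split. unfold seg in *; lra.
        apply Rabs_def2 in U2. apply Rabs_def2 in V2. apply Rabs_def1; lra.
      - destruct (Hl s' t' Hst') as [[C1 C2] _]. split.
        apply cont_on_sub with (seg 0 1); auto. intros u [Hu _]; auto.
        intros u [Hu _]; auto.
      - split.
        + apply cont_on_comp. apply cont_on_sub with (seg 0 1); auto. intros u [Hu _]; auto.
          intros u [Hu1 Hu2]. apply Hgc. apply HKV; auto.
        + intros u [Hu1 Hu2]. destruct (Hg i (K s' t' u)) as [A1 A2]. apply HKV; auto.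
          split; auto. eapply HUD; eauto.
      - split; auto.
      - split; auto.
      - destruct (Hl s' t' Hst') as [[_ C2] _]. rewrite <- (proj2 (C2 x Hx)), Hg'; auto. }
    destruct (Hgc i (K s t y) ltac:(apply HKV; auto) e He) as (eta & Heta & HG).
    destruct (cont_on2_segment E h a b s t y HE Hh Hab Hst Hy eta Heta) as (d3 & Hd3 & HK3).
    exists (Rmin d (Rmin d2 d3)). split. repeat apply Rmin_pos; auto.
    intros s' t' Hst' As At.
    assert (M1 := Rmin_l d (Rmin d2 d3)). assert (M2 := Rmin_r d (Rmin d2 d3)).
    assert (M3 := Rmin_l d2 d3). assert (M4 := Rmin_r d2 d3).
    rewrite (Form s t Hst) by auto.
    rewrite (Form s' t' Hst'); [| lra | lra | apply HUr, HPx; auto; lra].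
    apply HG. apply HK3; auto; try lra. rewrite Rminus_diag, Rabs_R0; auto.
  - intros s t Hst. destruct (Hl s t Hst) as [[_ H] _]. rewrite <- K1. auto.
  - destruct (Hl a b Hab) as [H H0]. rewrite <- H0.
    (* The segment from the base point to itself is a constant path, and so is its lift. *)
    apply (lift_unique phi Om (seg 0 1) (K a b) (l a b) (fun _ => l a b 0) 0 1 Hcov (interval_seg 0 1));
      auto.
    split.
    + intros s _ e He. exists 1. split. lra. intros. rewrite Cmod_sub_diag. auto.
    + intros s _. rewrite H0. split; auto. rewrite Ez. unfold K. f_equal; ring.
Qed.

(** * Boundary behaviour of lifts *)

Lemma ValAdh_eps (u : nat -> R) (l : R) :
  ValAdh u l -> forall e N, 0 < e -> exists n, (N <= n)%nat /\ Rabs (u n - l) < e.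
Proof.
  intros H e N He. apply (H (fun x => Rabs (x - l) < e) N).
  exists (mkposreal e He). intros x Hx. exact Hx.
Qed.

Lemma bolzano_weierstrass_C (w : nat -> C) :
  (forall n, Cmod (w n) <= 1) ->
  exists b, forall e N, 0 < e -> exists n, (N <= n)%nat /\ Cmod (w n - b) < e.
Proof.
  intros Hw.
  assert (B : forall n, -1 <= fst (w n) <= 1 /\ -1 <= snd (w n) <= 1).
  { intros n. specialize (Hw n). generalize (fst_le_Cmod (w n)) (snd_le_Cmod (w n)); intros A1 A2.
    split; apply Rabs_le_between; lra. }
  destruct (Bolzano_Weierstrass (fun n => fst (w n)) _ (compact_P3 (-1) 1) (fun n => proj1 (B n)))
    as [x Hx].
  assert (Hk : forall n, exists k, (n <= k)%nat /\ Rabs (fst (w k) - x) < / (INR n + 1)).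
  { intros n. apply (ValAdh_eps _ _ Hx). apply Rinv_0_lt_compat. generalize (pos_INR n); lra. }
  set (k := fun n => proj1_sig (constructive_indefinite_description _ (Hk n))).
  assert (Kk : forall n, (n <= k n)%nat /\ Rabs (fst (w (k n)) - x) < / (INR n + 1)).
  { intros n. unfold k. destruct constructive_indefinite_description; auto. }
  destruct (Bolzano_Weierstrass (fun n => snd (w (k n))) _ (compact_P3 (-1) 1)
     (fun n => proj2 (B (k n)))) as [y Hy].
  exists (x, y). intros e N He.
  destruct (archimed_cor1 (e / 2) ltac:(lra)) as (M & HM & HM0).
  destruct (ValAdh_eps _ _ Hy (e / 2) (Nat.max N M) ltac:(lra)) as (n & Hn & Hs).
  destruct (Kk n) as [K1 K2].
  exists (k n). split. lia. eapply Rle_lt_trans. apply Cmod_le_abs.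
  change (Rabs (fst (w (k n)) - x) + Rabs (snd (w (k n)) - y) < e).
  assert (/ (INR n + 1) <= / INR M).
  { apply Rinv_le_contravar. apply lt_0_INR; auto.
    assert (INR M <= INR n) by (apply le_INR; lia). lra. }
  lra.
Qed.

Lemma Cholomorphic_hol_disc (phi : C -> C) : Cholomorphic_on Disc phi -> hol_disc phi.
Proof.
  intros H z Hz. assert (HD : Disc z) by (unfold Disc; rewrite Cnorm_Cmod; auto).
  destruct (H z HD) as [l Hl]. exists l. apply Cderiv_of_eps. intros e He.
  destruct (Hl e He) as (d & Hd & K). exists (Rmin d (1 - Cmod z)).
  split. apply Rmin_pos; lra. intros w Hw.
  assert (A := Rlt_le_trans _ _ _ Hw (Rmin_r _ _)).
  assert (HDw : Disc w) by (unfold Disc; rewrite Cnorm_Cmod; generalize (Cmod_sub_rev w z); lra).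
  specialize (K w HDw). rewrite Cdist_Cmod, Cnorm_Cmod in K. apply K.
  eapply Rlt_le_trans; [exact Hw|apply Rmin_l].
Qed.

Lemma Cconj_mult_unit (b : C) : Cmod b = 1 -> (b * Cconj b)%C = 1.
Proof.
  intros H. assert (K := Cmod_sqr b). rewrite H in K. destruct b as [x y].
  unfold Cmult, Cconj, RtoC; simpl in *. f_equal; nra.
Qed.

Lemma cpath_clamp (c : R -> C) : cont_on (seg 0 1) c -> cpath (fun s => c (clamp s)).
Proof.
  intros H s e He. destruct (H (clamp s) (clamp_range s) e He) as (d & Hd & K).
  exists d. split; auto. intros s' Hs'. apply K. apply clamp_range.
  eapply Rle_lt_trans. apply clamp_lip. auto.
Qed.

Definition strip (a : R) (s t : R) : Prop := 0 < s < a /\ 0 <= t <= 1.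

Lemma convex_between (x y k : R) :
  0 <= k <= 1 -> Rmin x y <= x + k * (y - x) <= Rmax x y.
Proof. intros Hk. unfold Rmin, Rmax. destruct Rle_dec; nra. Qed.

Lemma convex2_strip (a : R) : convex2 (strip a).
Proof.
  intros s t s' t' k [H1 H2] [H3 H4] Hk. unfold strip.
  generalize (convex_between s s' k Hk) (convex_between t t' k Hk).
  unfold Rmin, Rmax. repeat destruct Rle_dec; lra.
Qed.

(** As |a| = 1, the polynomial of [mobius_components] has the value fst a (1 + r^2) - 2 r at [a].
    Moving from [a] to [z] costs at most 2 d through the real part and 2 d through |z|^2 >= 1 - 2 d,
    whence the margin 4 d. *)
Lemma crossing_start (a z : C) (r d : R) :
  0 <= r <= 1 -> Cmod a = 1 -> Cmod z < 1 -> Cmod (z - a) <= d ->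
  fst a * (1 + r * r) - 2 * r + 4 * d <= 0 ->
  fst z * (1 + r * r) - r * (1 + Cmod z ^ 2) <= 0.
Proof.
  intros Hr Ha Hz Hd H. assert (H1 := fst_le_Cmod (z - a)). simpl in H1.
  assert (H2 := Rle_abs (fst z + - fst a)). assert (H3 := Cmod_sub_rev a z).
  rewrite Cmod_sub_comm in H3. assert (H0 := Cmod_ge_0 z).
  assert (1 - 2 * d <= Cmod z ^ 2) by nra.
  assert (fst z * (1 + r * r) <= (fst a + d) * (1 + r * r)) by (apply Rmult_le_compat_r; nra).
  assert (0 <= d) by (generalize (Cmod_ge_0 (z - a)); lra).
  assert (r * (2 - 2 * d) <= r * (1 + Cmod z ^ 2)) by (apply Rmult_le_compat_l; lra).
  assert (r * r <= 1) by nra. assert (d * (r * r) <= d) by nra. assert (r * d <= d) by nra. lra.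
Qed.

(** At z = 1 the right-hand side is (1 - r)^2 = 3 d, with d the allowed distance: 2 d may be lost
    through the real part, and the remaining d pays for the imaginary part. *)
Lemma crossing_end (z : C) (r : R) :
  0 <= r < 1 -> Cmod z < 1 -> Cmod (z - 1) <= (1 - r) * (1 - r) / 3 ->
  Rabs (snd z) * (1 - r * r) <= fst z * (1 + r * r) - r * (1 + Cmod z ^ 2).
Proof.
  intros Hr Hz H. set (d := (1 - r) * (1 - r) / 3) in *.
  assert (Ed : (1 - r) * (1 - r) = 3 * d) by (unfold d; field).
  assert (H1 := fst_le_Cmod (z - 1)). assert (H2 := snd_le_Cmod (z - 1)). simpl in H1, H2.
  replace (snd z + - 0) with (snd z) in H2 by ring.
  assert (H3 := Rle_abs (- (fst z + - (1)))). rewrite Rabs_Ropp in H3.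
  assert (H0 := Cmod_ge_0 z). assert (P := Rabs_pos (snd z)).
  assert (Cmod z ^ 2 <= 1) by nra.
  assert ((1 - d) * (1 + r * r) <= fst z * (1 + r * r)) by (apply Rmult_le_compat_r; nra).
  assert (0 <= d) by lra. assert (r * r <= 1) by nra. assert (d * (r * r) <= d) by nra.
  assert (Rabs (snd z) * (1 - r * r) <= d) by nra.
  assert (r * (1 + Cmod z ^ 2) <= r * 2) by (apply Rmult_le_compat_l; lra). lra.
Qed.

(** * The edge s = 0 over a point [p] outside [Om] *)

Section Boundary.

Variables (phi : C -> C) (Om : C -> Prop) (p : C) (M : R) (h L : R -> R -> C).
Hypothesis Hcov : covering_map phi Om.
Hypothesis Hhol : hol_disc phi.
Hypothesis HM : 0 < M.
Hypothesis Hb : forall z, Cmod z < 1 -> Cmod (phi z - p) <= M.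
Hypothesis Hp : ~ Om p.
Hypothesis Hlim : forall e, 0 < e -> exists d, 0 < d /\
  forall s t, strip d s t -> Cmod (h s t - p) < e.
Hypothesis HL : lift_on2 phi (strip 1) h L.

(** The rotation by [b] brings the boundary point [b] to 1, so that the real parameter [r] of the
    Moebius map runs along the radius to [b]. *)
Definition normalized (b z : C) : C := ((/ M)%R * (phi (b * z) + - p))%C.

Lemma Cmod_normalized (b z : C) : Cmod (normalized b z) = Cmod (phi (b * z) - p) / M.
Proof.
  unfold normalized. rewrite Cmod_mult, Cmod_R, Rabs_right.
  unfold Rdiv, Cminus. ring. apply Rle_ge, Rlt_le, Rinv_0_lt_compat; auto.
Qed.

Lemma normalized_pos (b z : C) : Cmod b = 1 -> Cmod z < 1 -> 0 < Cmod (normalized b z).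
Proof.
  intros Hb1 Hz. rewrite Cmod_normalized. apply Rdiv_lt_0_compat; auto.
  apply Cmod_gt_0. intros E. apply Hp.
  replace p with (phi (b * z)).
  apply (covering_image phi Om); auto.
  rewrite Cmod_mult, Hb1. lra.
  replace (phi (b * z)%C) with (phi (b * z) - p + p)%C by ring. rewrite E. ring.
Qed.

(** The path is the image under [L] of the segment between the two parameters, rotated so that [b]
    becomes 1. The strip is convex, so [h] on that segment, and hence [phi] on the unrotated path,
    stays close to [p]. *)
Lemma boundary_crossing (b : C) (r eps a sa ta sb tb : R) :
  Cmod b = 1 -> 0 <= r < 1 -> 0 < eps -> a <= 1 ->
  (forall s t, strip a s t -> Cmod (h s t - p) < M * eps) ->
  strip a sa ta -> strip a sb tb ->
  fst (Cconj b * L sa ta)%C * (1 + r * r) - r * (1 + Cmod (Cconj b * L sa ta) ^ 2) <= 0 ->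
  Cmod (L sb tb - b) <= (1 - r) * (1 - r) / 3 ->
  Cmod (normalized b r) ^ 8 <= eps.
Proof.
  intros Hb1 Hr He Ha Hsm Hsa Hsb Hst Hen. destruct HL as [LC LD].
  assert (Sub : forall s t, strip a s t -> strip 1 s t).
  { intros s t [H1 H2]. split; lra. }
  set (g := fun k => L (sa + k * (sb - sa)) (ta + k * (tb - ta))).
  assert (Hg : forall k, 0 <= k <= 1 -> strip a (sa + k * (sb - sa)) (ta + k * (tb - ta))).
  { intros k Hk. apply convex2_strip; auto. }
  assert (Bc : Cmod (Cconj b) = 1) by (rewrite Cmod_conj; auto).
  assert (Eb : forall z, (b * (Cconj b * z))%C = z).
  { intros z. rewrite Cmult_assoc, Cconj_mult_unit by auto. ring. }
  assert (D : forall s, Cmod (Cconj b * g (clamp s)) < 1).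
  { intros s. rewrite Cmod_mult, Bc, Rmult_1_l. apply LD. apply Sub, Hg, clamp_range. }
  assert (G0 : g (clamp 0) = L sa ta) by (unfold g; rewrite clamp_id by lra; f_equal; ring).
  assert (G1 : g (clamp 1) = L sb tb) by (unfold g; rewrite clamp_id by lra; f_equal; ring).
  apply (crossing_estimate_mobius (normalized b) (fun s => Cconj b * g (clamp s))%C r eps).
  - intros z Hz. destruct (Hhol (b * z)%C) as [l Hl]. rewrite Cmod_mult, Hb1; lra.
    eexists. unfold normalized. apply Cderiv_scal.
    apply (Cderiv_plus (fun z => phi (b * z)%C) (fun _ => - p)%C); [|apply Cderiv_const].
    apply (Cderiv_comp phi (fun z => b * z)%C); [|exact Hl].
    apply (Cderiv_scal _ _ (fun z => z)). apply Cderiv_id.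
  - intros z Hz. rewrite Cmod_normalized.
    apply Rmult_le_reg_r with M; auto. unfold Rdiv. rewrite Rmult_assoc, Rinv_l by lra.
    rewrite Rmult_1_r, Rmult_1_l. apply Hb. rewrite Cmod_mult, Hb1; lra.
  - lra.
  - apply (cpath_comp (fun z => Cconj b * z)%C (fun s => g (clamp s))).
    + apply cpath_clamp. apply cont_on2_path with (strip 1); auto. apply convex2_strip.
    + intros s. apply ccont_mult. apply ccont_const. apply ccont_id.
  - auto.
  - simpl. rewrite G0. auto.
  - apply (crossing_end (Cconj b * g (clamp 1))%C); auto.
    rewrite G1. eapply Rle_trans; [|exact Hen]. right.
    rewrite <- (Cconj_mult_unit b Hb1).
    replace (Cconj b * L sb tb - b * Cconj b)%C with (Cconj b * (L sb tb - b))%C by ring.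
    rewrite Cmod_mult, Bc. ring.
  - auto.
  - intros s. rewrite Cmod_normalized, Eb.
    destruct (LD _ _ (Sub _ _ (Hg (clamp s) (clamp_range s)))) as [_ E]. unfold g. rewrite E.
    apply Rmult_lt_reg_r with M; auto. unfold Rdiv. rewrite Rmult_assoc, Rinv_l by lra.
    rewrite Rmult_1_r, (Rmult_comm eps). apply Hsm. apply Hg, clamp_range.
Qed.

(** At a cluster point inside the disc, continuity of [phi] would give [phi b = p] and put [p] into
    [Om]. *)
Lemma cluster_unimodular (b : C) :
  (forall e d, 0 < e -> 0 < d -> exists s t, strip (Rmin 1 d) s t /\ Cmod (L s t - b) < e) ->
  Cmod b = 1.
Proof.
  intros H. destruct HL as [LC LD].
  assert (Sub : forall d s t, strip (Rmin 1 d) s t -> strip 1 s t /\ strip d s t).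
  { intros d s t [H1 H2]. generalize (Rmin_l 1 d) (Rmin_r 1 d). unfold strip. lra. }
  apply Rle_antisym.
  - apply Rnot_lt_le. intros Hl. destruct (H (Cmod b - 1) 1 ltac:(lra) ltac:(lra)) as (s & t & Hs & K).
    destruct (LD s t (proj1 (Sub _ _ _ Hs))) as [D _].
    rewrite Cmod_sub_comm in K. generalize (Cmod_sub_rev b (L s t)). lra.
  - apply Rnot_lt_le. intros Hl. apply Hp.
    replace p with (phi b). apply (covering_image phi Om); auto.
    assert (Hc := covering_ccont phi Om b Hcov Hl).
    assert (E : Cmod (phi b - p) = 0).
    { apply Rle_antisym; [|apply Cmod_ge_0]. apply Rnot_lt_le. intros Hpos.
      set (e := Cmod (phi b - p)) in *.
      destruct (Hc (e / 2) ltac:(lra)) as (d1 & P1 & K1).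
      destruct (Hlim (e / 2) ltac:(lra)) as (d2 & P2 & K2).
      destruct (H d1 d2 P1 P2) as (s & t & Hs & K).
      destruct (Sub _ _ _ Hs) as [S1 S2]. destruct (LD s t S1) as [_ E].
      specialize (K1 _ K). specialize (K2 _ _ S2). rewrite E in K1.
      assert (T := Cmod_triangle3 (phi b) (h s t) p). fold e in T.
      rewrite (Cmod_sub_comm (phi b)) in T. lra. }
    apply Cmod_eq_0 in E. replace (phi b) with (phi b - p + p)%C by ring. rewrite E. ring.
Qed.

Lemma inv_seq_small (d : R) : 0 < d ->
  exists N, forall n, (N <= n)%nat -> / (INR n + 2) < d.
Proof.
  intros Hd. destruct (archimed_cor1 d Hd) as (N & HN & HN0). exists N. intros n Hn.
  eapply Rle_lt_trans; [|exact HN]. apply Rinv_le_contravar. apply lt_0_INR; auto.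
  assert (INR N <= INR n) by (apply le_INR; auto). lra.
Qed.

Lemma inv_seq_range (n : nat) : 0 < / (INR n + 2) < 1.
Proof.
  assert (P := pos_INR n). split. apply Rinv_0_lt_compat; lra.
  rewrite <- Rinv_1. apply Rinv_lt_contravar; lra.
Qed.

(* If [L] had a second cluster point [a], images under [L] of segments close to the edge
   [s = 0] would join neighbourhoods of [a] and [b] while [phi] is close to [p] on them. *)
Lemma boundary_limit_exists :
  exists b, Cmod b = 1 /\
    forall e, 0 < e -> exists d, 0 < d /\ forall s t, strip d s t -> Cmod (L s t - b) < e.
Proof.
  assert (LD := proj2 HL).
  (* The shift by 2 keeps every term, including the one for n = 0, strictly inside (0, 1). *)
  destruct (bolzano_weierstrass_C (fun n => L (/ (INR n + 2)) 0)) as [b Hbc].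
  { intros n. left. apply LD. split. apply inv_seq_range. lra. }
  assert (Hbc' : forall e d, 0 < e -> 0 < d -> exists s,
     0 < s < Rmin 1 d /\ Cmod (L s 0 - b) < e).
  { intros e d He Hd. destruct (inv_seq_small d Hd) as [N HN].
    destruct (Hbc e N He) as (n & Hn & K). exists (/ (INR n + 2)). split; auto.
    split. apply inv_seq_range. apply Rmin_glb_lt. apply inv_seq_range. auto. }
  assert (Hb1 : Cmod b = 1).
  { apply cluster_unimodular. intros e d He Hd.
    destruct (Hbc' e d He Hd) as (s & Hs & K). exists s, 0. split; auto. split; auto; lra. }
  exists b. split; auto. apply NNPP. intros HN.
  assert (HN' : exists e, 0 < e /\ forall d, 0 < d -> exists s t, strip d s t /\ e <= Cmod (L s t - b)).
  { apply NNPP. intros HN2. apply HN. intros e He. apply NNPP. intros HN3. apply HN2.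
    exists e. split; auto. intros d Hd. apply NNPP. intros HN4. apply HN3.
    exists d. split; auto. intros s t Hst. apply Rnot_le_lt. intros Hle. apply HN4. eauto. }
  destruct HN' as (e0 & He0 & Hfar).
  assert (Hsq : forall n : nat, exists st : R * R,
     strip (/ (INR n + 2)) (fst st) (snd st) /\ e0 <= Cmod (L (fst st) (snd st) - b)).
  { intros n. destruct (Hfar _ (proj1 (inv_seq_range n))) as (s & t & H). exists (s, t); auto. }
  set (q := fun n => proj1_sig (constructive_indefinite_description _ (Hsq n))).
  assert (Hq : forall n, strip (/ (INR n + 2)) (fst (q n)) (snd (q n)) /\
                e0 <= Cmod (L (fst (q n)) (snd (q n)) - b)).
  { intros n. unfold q. destruct constructive_indefinite_description; auto. }
  clearbody q.
  assert (Hq1 : forall n, strip 1 (fst (q n)) (snd (q n))).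
  { intros n. destruct (Hq n) as [[H1 H2] _]. generalize (inv_seq_range n). unfold strip. lra. }
  destruct (bolzano_weierstrass_C (fun n => L (fst (q n)) (snd (q n)))) as [a Hac].
  { intros n. left. apply LD. auto. }
  assert (Hac' : forall e d, 0 < e -> 0 < d -> exists s t,
     strip (Rmin 1 d) s t /\ e0 <= Cmod (L s t - b) /\ Cmod (L s t - a) < e).
  { intros e d He Hd. destruct (inv_seq_small d Hd) as [N HN1].
    destruct (Hac e N He) as (n & Hn & K). exists (fst (q n)), (snd (q n)).
    destruct (Hq n) as [[H1 H2] H3]. split; auto. split; auto. split. lra.
    specialize (HN1 n Hn). generalize (inv_seq_range n); intros. apply Rmin_glb_lt; lra. }
  assert (Ha1 : Cmod a = 1).
  { apply cluster_unimodular. intros e d He Hd.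
    destruct (Hac' e d He Hd) as (s & t & Hs & _ & K). eauto. }
  assert (Hab : e0 / 2 <= Cmod (a - b)).
  { destruct (Hac' (e0 / 2) 1 ltac:(lra) ltac:(lra)) as (s & t & _ & K1 & K2).
    generalize (Cmod_triangle3 (L s t) a b). lra. }
  (* Rotated so that [b] is at 1; being unimodular and different from 1, [a'] has real part below
     1. *)
  set (a' := (Cconj b * a)%C).
  assert (Bc : Cmod (Cconj b) = 1) by (rewrite Cmod_conj; auto).
  assert (Ha' : Cmod a' = 1) by (unfold a'; rewrite Cmod_mult, Bc, Ha1; ring).
  assert (Hx : fst a' < 1).
  { assert (N : 0 < Cmod (a' - 1)).
    { rewrite <- (Cconj_mult_unit b Hb1). unfold a'.
      replace (Cconj b * a - b * Cconj b)%C with (Cconj b * (a - b))%C by ring.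
      rewrite Cmod_mult, Bc. lra. }
    assert (S1 := Cmod_sqr a'). rewrite Ha' in S1.
    assert (S2 := Cmod_sqr (a' - 1)).
    assert (S3 : 0 < Cmod (a' - 1) ^ 2) by (apply pow_lt; auto). rewrite S2 in S3.
    clear - S1 S3. simpl in *. nra. }
  (* [k] is 1 - r and must make (fst a' - 1)(1 + r^2) + k^2 negative: k^2 is at most a quarter of 1
     - fst a', and the bound 1 / 2 keeps [r] nonnegative. *)
  set (k := Rmin (1 / 2) ((1 - fst a') / 2)).
  assert (Hk : 0 < k <= 1 / 2 /\ k <= (1 - fst a') / 2).
  { split; [split|]. apply Rmin_pos; lra. apply Rmin_l. apply Rmin_r. }
  set (r := 1 - k).
  assert (Hr : 0 <= r < 1) by (unfold r; lra).
  assert (Hneg : fst a' * (1 + r * r) - 2 * r < 0).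
  { replace (fst a' * (1 + r * r) - 2 * r) with ((fst a' - 1) * (1 + r * r) + k * k)
      by (unfold r; ring). nra. }
  set (X := fst a' * (1 + r * r) - 2 * r) in *.
  assert (Hpos := normalized_pos b r Hb1 ltac:(rewrite Cmod_R, Rabs_right; lra)).
  (* The crossing estimate would bound a positive number by its own half. *)
  set (eps := Cmod (normalized b r) ^ 8 / 2).
  assert (Heps : 0 < Cmod (normalized b r) ^ 8) by (apply pow_lt; auto).
  destruct (Hlim (M * eps)) as (d & Hd & Hsm).
  { apply Rmult_lt_0_compat; auto. unfold eps; lra. }
  (* The distance [- X / 4] exactly uses up the margin of [crossing_start]. *)
  destruct (Hac' (- X / 4) d ltac:(lra) Hd) as (sa & ta & Hsa & _ & Ka).
  destruct (Hbc' ((1 - r) * (1 - r) / 3) d) as (sb & Hsb & Kb); auto.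
  { unfold r. nra. }
  assert (C : Cmod (normalized b r) ^ 8 <= eps).
  { apply (boundary_crossing b r eps (Rmin 1 d) sa ta sb 0); auto.
    - unfold eps; lra.
    - apply Rmin_l.
    - intros s t [H1 H2]. apply Hsm. split; auto. generalize (Rmin_r 1 d). lra.
    - split; auto; lra.
    - apply (crossing_start a' (Cconj b * L sa ta) r (- X / 4)); auto. lra.
      + rewrite Cmod_mult, Bc, Rmult_1_l. apply LD.
        destruct Hsa as [H1 H2]. split; auto. generalize (Rmin_l 1 d). lra.
      + unfold a'. replace (Cconj b * L sa ta - Cconj b * a)%C with (Cconj b * (L sa ta - a))%C by ring.
        rewrite Cmod_mult, Bc. lra.
      + fold X. lra.
    - lra. }
  unfold eps in C. lra.
Qed.

(* Lindelof's theorem for the curve [s |-> L s 0]. *)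
Lemma boundary_radial_limit (b : C) :
  Cmod b = 1 ->
  (forall e, 0 < e -> exists d, 0 < d /\ forall s t, strip d s t -> Cmod (L s t - b) < e) ->
  radial_limit phi b p.
Proof.
  intros Hb1 Hlb e He. assert (LD := proj2 HL).
  (* The eighth power of the estimate is undone at the end and leaves |phi - p| <= e / 2. *)
  set (eps := (e / (2 * M)) ^ 8).
  assert (Hq : 0 < e / (2 * M)) by (apply Rdiv_lt_0_compat; lra).
  assert (Heps : 0 < eps) by (apply pow_lt; auto).
  destruct (Hlim (M * eps)) as (d & Hd & Hsm). apply Rmult_lt_0_compat; auto.
  set (a := Rmin 1 d). assert (Ha : 0 < a) by (apply Rmin_pos; lra).
  assert (Ha1 : a <= 1) by apply Rmin_l. assert (Had : a <= d) by apply Rmin_r.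
  set (z := (Cconj b * L (a / 2) 0)%C).
  assert (Sa : strip a (a / 2) 0) by (unfold strip; lra).
  assert (Hz : Cmod z < 1).
  { unfold z. rewrite Cmod_mult, Cmod_conj, Hb1, Rmult_1_l. apply LD.
    unfold strip in *; lra. }
  (* With m = |z| and k = 1 - r, the half plane condition at the fixed point [z] follows from k^2 m
     <= (1 - k)(1 - m)^2, which holds once k <= (1 - m)^2 / 4. The minimum with 1 makes [r]
     positive. *)
  exists (Rmin 1 ((1 - Cmod z) * (1 - Cmod z) / 4)). split. apply Rmin_pos; nra.
  intros r Hr.
  assert (M1 := Rmin_l 1 ((1 - Cmod z) * (1 - Cmod z) / 4)).
  assert (M2 := Rmin_r 1 ((1 - Cmod z) * (1 - Cmod z) / 4)).
  destruct (Hlb ((1 - r) * (1 - r) / 3)) as (d2 & Hd2 & K2). nra.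
  set (sb := Rmin a d2 / 2).
  assert (M3 := Rmin_l a d2). assert (M4 := Rmin_r a d2).
  assert (M5 : 0 < Rmin a d2) by (apply Rmin_pos; auto).
  assert (C : Cmod (normalized b r) ^ 8 <= eps).
  { apply (boundary_crossing b r eps a (a / 2) 0 sb 0); auto.
    - lra.
    - intros s t [H1 H2]. apply Hsm. split; auto. lra.
    - unfold strip, sb; lra.
    - fold z. assert (F := fst_le_Cmod z). assert (F' := Rle_abs (fst z)).
      assert (G := Cmod_ge_0 z). set (m := Cmod z) in *. clearbody m.
      assert (X1 : fst z * (1 + r * r) <= m * (1 + r * r)) by (apply Rmult_le_compat_r; nra).
      set (k := 1 - r). assert (Hk : 0 < k <= (1 - m) * (1 - m) / 4) by (unfold k; lra).
      assert (Q1 : (1 - m) * (1 - m) <= 1) by nra.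
      replace (r * (1 + m ^ 2)) with (m * (1 + r * r) + ((1 - k) * ((1 - m) * (1 - m)) - k * k * m))
        by (unfold k; ring).
      assert (k * k * m <= k * k) by nra. assert (k * k <= k) by nra. nra.
    - left. apply K2. unfold strip, sb; lra. }
  rewrite Cmod_normalized in C.
  assert (C' : Cmod (phi (b * r) - p) / M <= e / (2 * M)).
  { apply Rnot_lt_le. intros Hlt. apply (Rle_not_lt _ _ C). unfold eps.
    assert (K : forall n x y, 0 < x -> x < y -> x ^ S n < y ^ S n).
    { intros n x y Hx Hxy. induction n. simpl; lra.
      change (x * x ^ S n < y * y ^ S n).
      assert (0 < x ^ S n) by (apply pow_lt; auto). nra. }
    apply K; auto. }
  rewrite Cdist_Cmod.
  replace (Cscal r b) with (b * r)%C
    by (destruct b; unfold Cscal, Cmult, RtoC; simpl; f_equal; ring).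
  apply Rle_lt_trans with (e / 2); [|lra].
  apply Rmult_le_reg_r with (/ M). apply Rinv_0_lt_compat; auto.
  replace (e / 2 * / M) with (e / (2 * M)) by (field; lra). exact C'.
Qed.

End Boundary.

(** * Extended lifts *)

(** A tube argument: the edge is compact, and [interval_ind] lets the height [k] of the controlled
    part grow to 1. *)
Lemma uniform_edge (h : R -> R -> C) (p : C) :
  continuous_square h -> (forall t, 0 <= t <= 1 -> h 0 t = p) ->
  forall e, 0 < e -> exists d, 0 < d /\ forall s t, strip d s t -> Cmod (h s t - p) < e.
Proof.
  intros Hh H0 e He.
  assert (K : exists d, 0 < d /\ forall s t, 0 < s < d -> 0 <= t <= 1 -> Cmod (h s t - p) < e).
  { apply (interval_ind (fun k => exists d, 0 < d /\
      forall s t, 0 < s < d -> 0 <= t <= k -> Cmod (h s t - p) < e) 0 1).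
    - lra.
    - destruct (Hh 0 0 ltac:(lra) ltac:(lra) e He) as (d & Hd & K).
      exists (Rmin 1 d). split. apply Rmin_pos; lra. intros s t Hs Ht.
      generalize (Rmin_l 1 d) (Rmin_r 1 d); intros.
      assert (t = 0) as -> by lra. rewrite <- (H0 0), <- Cdist_Cmod by lra.
      apply K; try lra; rewrite Rminus_0_r, Rabs_right; lra.
    - intros k Hk. destruct (Hh 0 k ltac:(lra) Hk e He) as (d & Hd & K).
      exists d. split; auto. intros x y Hx Hy Hxk Hyk (d' & Hd' & K').
      exists (Rmin 1 (Rmin d d')). split. repeat apply Rmin_pos; lra.
      generalize (Rmin_l 1 (Rmin d d')) (Rmin_r 1 (Rmin d d')) (Rmin_l d d') (Rmin_r d d').
      intros M1 M2 M3 M4 s t Hs Ht. destruct (Rle_dec t x) as [Htx|Htx].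
      + apply K'; lra.
      + rewrite <- (H0 k), <- Cdist_Cmod by auto. apply K; try lra.
        rewrite Rminus_0_r, Rabs_right; lra.
        apply Rabs_def2 in Hxk. apply Rabs_def2 in Hyk. apply Rabs_def1; lra. }
  destruct K as (d & Hd & K). exists d. split; auto. intros s t [Hs Ht]. auto.
Qed.

(** Over a point of [Om] the edge belongs to [E] and [L] lifts a constant path on it, so [L] is
    constant there; otherwise the boundary analysis applies. [E] is a parameter so that reflection
    covers the edge s = 1, and the clause [ph = L 0 0] serves a base point on the edge. *)
Lemma lift_edge (phi : C -> C) (Om : C -> Prop) (E : R -> R -> Prop) (h L : R -> R -> C) (p : C) :
  covering_map phi Om -> Cholomorphic_on Disc phi -> Cbounded Om ->
  continuous_square h -> (forall t, 0 <= t <= 1 -> h 0 t = p) ->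
  lift_on2 phi E h L -> (forall s t, strip 1 s t -> E s t) ->
  (Om p -> forall t, 0 <= t <= 1 -> E 0 t) ->
  exists ph, phibar phi ph p /\ (Om p -> ph = L 0 0) /\
    forall t, 0 <= t <= 1 -> forall e, 0 < e -> exists d, 0 < d /\ d <= 1 /\
      forall s t', 0 < s < d -> 0 <= t' <= 1 -> Rabs (t' - t) < d -> Cmod (L s t' - ph) < e.
Proof.
  intros Hcov Hhol [M0 HM0] Hh H0 [LC LD] HE1 HE2.
  destruct (classic (Om p)) as [Hp|Hp].
  - specialize (HE2 Hp).
    assert (S0 : seg 0 1 0) by (unfold seg; lra).
    assert (Hconst : forall t, 0 <= t <= 1 -> L 0 t = L 0 0).
    { intros t Ht.
      apply (lift_unique phi Om (seg 0 1) (fun _ => p) (fun t => L 0 t) (fun _ => L 0 0) 0 t Hcov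
        (interval_seg 0 1)); auto.
      - split.
        + intros u Hu e He. destruct (LC 0 u (HE2 u Hu) e He) as (d & Hd & K).
          exists d. split; auto. intros v Hv Huv. apply K; auto.
          rewrite Rminus_diag, Rabs_R0; auto.
        + intros u Hu. destruct (LD 0 u (HE2 u Hu)) as [D E1]. rewrite E1, H0; auto.
      - split.
        + intros u _ e He. exists 1. split. lra. intros. rewrite Cmod_sub_diag; auto.
        + intros u _. destruct (LD 0 0 (HE2 0 S0)) as [D E1]. rewrite E1, H0; auto. }
    exists (L 0 0). destruct (LD 0 0 (HE2 0 S0)) as [D E1]. split; [|split].
    + left. split. unfold Disc. rewrite Cnorm_Cmod; auto. rewrite E1. apply H0; auto.
    + auto.
    + intros t Ht e He. destruct (LC 0 t (HE2 t Ht) e He) as (d & Hd & K).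
      exists (Rmin 1 d). split. apply Rmin_pos; lra. split. apply Rmin_l.
      generalize (Rmin_l 1 d) (Rmin_r 1 d); intros M1 M2 s t' Hs Ht' Htt.
      rewrite <- (Hconst t Ht). apply K. apply HE1. unfold strip; lra.
      rewrite Rminus_0_r, Rabs_right; lra. lra.
  - set (M := M0 + Cmod p + 1).
    assert (HOM : forall w, Om w -> Cmod w <= M0) by (intros w Hw; rewrite <- Cnorm_Cmod; auto).
    assert (Hb : forall z, Cmod z < 1 -> Cmod (phi z - p) <= M).
    { intros z Hz. assert (A := HOM _ (covering_image phi Om z Hcov Hz)).
      unfold Cminus. eapply Rle_trans. apply Cmod_triangle. rewrite Cmod_opp. unfold M. lra. }
    assert (HM : 0 < M).
    { assert (A := HOM _ (covering_image phi Om 0 Hcov ltac:(rewrite Cmod_0; lra))).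
      generalize (Cmod_ge_0 (phi 0)) (Cmod_ge_0 p). unfold M. lra. }
    assert (HL : lift_on2 phi (strip 1) h L).
    { split; auto. intros s t Hst e He. destruct (LC s t (HE1 s t Hst) e He) as (d & Hd & K).
      exists d. split; auto. }
    assert (Hu := uniform_edge h p Hh H0).
    assert (Hhol' := Cholomorphic_hol_disc phi Hhol).
    destruct (boundary_limit_exists phi Om p M h L Hcov Hhol' HM Hb Hp Hu HL) as (b & Hb1 & Hlb).
    exists b. split; [|split].
    + right. split. rewrite Cnorm_Cmod; auto.
      apply (boundary_radial_limit phi p M h L); auto.
    + tauto.
    + intros t Ht e He. destruct (Hlb e He) as (d & Hd & K).
      exists (Rmin 1 d). split. apply Rmin_pos; lra. split. apply Rmin_l.
      generalize (Rmin_r 1 d); intros M2 s t' Hs Ht' _. apply K. unfold strip; lra.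
Qed.

Lemma continuous_square_reflect (h : R -> R -> C) :
  continuous_square h -> continuous_square (fun s t => h (1 - s) t).
Proof.
  intros H s t Hs Ht e He. destruct (H (1 - s) t ltac:(lra) Ht e He) as (d & Hd & K).
  exists d. split; auto. intros s' t' Hs' Ht' As At. apply K; auto; try lra.
  rewrite <- Rabs_Ropp. replace (- _) with (s' - s) by ring. auto.
Qed.

(** The part with 0 < s < 1 is dense in the square. *)
Lemma continuous_square_eq (h1 h2 : R -> R -> C) :
  continuous_square h1 -> continuous_square h2 ->
  (forall s t, 0 < s < 1 -> 0 <= t <= 1 -> h1 s t = h2 s t) ->
  forall s t, 0 <= s <= 1 -> 0 <= t <= 1 -> h1 s t = h2 s t.
Proof.
  intros H1 H2 E s t Hs Ht.
  assert (Z : Cmod (h1 s t - h2 s t) = 0).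
  { apply Rle_antisym; [|apply Cmod_ge_0]. apply Rnot_lt_le. intros Hpos.
    set (e := Cmod (h1 s t - h2 s t)) in *.
    destruct (H1 s t Hs Ht (e / 2) ltac:(lra)) as (d1 & P1 & K1).
    destruct (H2 s t Hs Ht (e / 2) ltac:(lra)) as (d2 & P2 & K2).
    set (k := Rmin (1 / 2) (Rmin d1 d2 / 2)).
    assert (M0 : 0 < Rmin d1 d2) by (apply Rmin_pos; auto).
    assert (M1 : 0 < k) by (apply Rmin_pos; lra).
    assert (M2 : k <= 1 / 2) by apply Rmin_l. assert (M3 : k <= Rmin d1 d2 / 2) by apply Rmin_r.
    assert (M4 := Rmin_l d1 d2). assert (M5 := Rmin_r d1 d2).
    assert (X : exists s', 0 < s' < 1 /\ Rabs (s' - s) < Rmin d1 d2).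
    { destruct (Rle_dec s (1 / 2)).
      - exists (s + k / 2). split. lra. apply Rabs_def1; lra.
      - exists (s - k / 2). split. lra. apply Rabs_def1; lra. }
    destruct X as (s' & Hs' & As).
    specialize (K1 s' t ltac:(lra) Ht ltac:(lra) ltac:(rewrite Rminus_diag, Rabs_R0; auto)).
    specialize (K2 s' t ltac:(lra) Ht ltac:(lra) ltac:(rewrite Rminus_diag, Rabs_R0; auto)).
    rewrite Cdist_Cmod in K1, K2. rewrite (E s' t Hs' Ht) in K1.
    assert (T := Cmod_triangle3 (h1 s t) (h2 s' t) (h2 s t)). fold e in T.
    rewrite (Cmod_sub_comm (h1 s t)) in T. lra. }
  apply Cmod_eq_0 in Z. replace (h1 s t) with (h1 s t - h2 s t + h2 s t)%C by ring.
  rewrite Z. ring.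
Qed.

(** The open strip together with the base line, which may be an edge. Uniqueness spreads along
    segments from the base point, so the domain has to contain it and be convex. *)
Definition rel_strip (s0 s t : R) : Prop := (0 < s < 1 \/ s = s0) /\ 0 <= t <= 1.

Lemma convex2_rel_strip (s0 : R) : 0 <= s0 <= 1 -> convex2 (rel_strip s0).
Proof.
  intros H0 s t s' t' k [H1 H2] [H3 H4] Hk.
  split; [|generalize (convex_between t t' k Hk); unfold Rmin, Rmax; repeat destruct Rle_dec; lra].
  destruct (Req_dec k 0) as [->|]. replace (s + 0 * (s' - s)) with s by ring; auto.
  destruct (Req_dec k 1) as [->|]. replace (s + 1 * (s' - s)) with s' by ring; auto.
  destruct (Req_dec s s') as [->|]. replace (s' + k * (s' - s')) with s' by ring; auto.
  left. assert (R1 : 0 <= s <= 1 /\ 0 <= s' <= 1) by lra.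
  destruct (Rlt_dec s s'); nra.
Qed.

(** If the base point lies on an edge, the lift is constant on that edge with value [zh], which lies
    in the disc over [z]; so the lifting equation extends to the edge. *)
Lemma lift_homotopy_lift_on2 (phi : C -> C) (p q z zh : C) (s0 : R) (h hh : R -> R -> C) :
  0 <= s0 <= 1 -> (forall t, 0 <= t <= 1 -> h 0 t = p) -> (forall t, 0 <= t <= 1 -> h 1 t = q) ->
  h s0 0 = z -> Disc zh -> phi zh = z ->
  lift_homotopy phi p q zh s0 h hh -> lift_on2 phi (rel_strip s0) h hh.
Proof.
  intros Hs0 Hp Hq Hz Hzh Ez (HC & _ & Hin & (ph & Hph & _) & (qh & Hqh & _) & E0).
  split.
  - intros s t [Hs Ht] e He. destruct (HC s t ltac:(lra) Ht e He) as (d & Hd & K).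
    exists d. split; auto. intros s' t' [Hs' Ht'] As At. rewrite <- Cdist_Cmod.
    apply K; auto. lra.
  - intros s t [Hs Ht]. rewrite <- Cnorm_Cmod.
    destruct (classic (0 < s < 1)) as [Hi|Hn]. apply Hin; auto.
    destruct Hs as [Hs|Hs]; [tauto|]. subst s.
    destruct (Req_dec s0 0) as [E|N0].
    + subst s0. rewrite Hph in * by lra. rewrite Hp in * by lra. subst. auto.
    + assert (s0 = 1) by lra. subst s0. rewrite Hqh in * by lra. rewrite Hq in * by lra.
      subst. auto.
Qed.

Lemma phibar_cDisc (phi : C -> C) (a v : C) : phibar phi a v -> cDisc a.
Proof. unfold phibar, cDisc, Disc. intros [[H _]|[H _]]; lra. Qed.

Lemma homotopy_lift (Om : C -> Prop) (phi : C -> C) (p q z zh : C) (h : R -> R -> C) (s0 : R) :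
  Cbounded Om -> Cholomorphic_on Disc phi -> covering_map phi Om ->
  Om z -> Disc zh -> phi zh = z ->
  continuous_square h -> (forall t, 0 <= t <= 1 -> path_epe Om p q (fun s => h s t)) ->
  0 <= s0 <= 1 -> h s0 0 = z ->
  exists hh : R -> R -> C,
    lift_homotopy phi p q zh s0 h hh /\
    (forall hh' : R -> R -> C, lift_homotopy phi p q zh s0 h hh' ->
       forall s t, 0 <= s <= 1 -> 0 <= t <= 1 -> hh' s t = hh s t).
Proof.
  intros Hbd Hhol Hcov Hz Hzh Ez Hh Hpath Hs0 Hs0z.
  assert (Hp : forall t, 0 <= t <= 1 -> h 0 t = p) by (intros t Ht; apply (Hpath t Ht)).
  assert (Hq : forall t, 0 <= t <= 1 -> h 1 t = q) by (intros t Ht; apply (Hpath t Ht)).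
  assert (Hin : forall s t, 0 < s < 1 -> 0 <= t <= 1 -> Om (h s t)).
  { intros s t Hs Ht. apply (Hpath t Ht); auto. }
  (* The open strip with those edges whose end point lies in [Om], so that a base point on an edge
     is included. Testing at height 0 suffices because [h] is constant on each edge. *)
  set (E := fun s t => (0 <= s <= 1 /\ Om (h s 0)) /\ 0 <= t <= 1).
  assert (HE : convex2 E).
  { intros s t s' t' k [[H1 H2] H3] [[H4 H5] H6] Hk.
    assert (Bs := convex_between s s' k Hk). assert (Bt := convex_between t t' k Hk).
    split; [split|].
    - revert Bs. unfold Rmin, Rmax; repeat destruct Rle_dec; lra.
    (* An abscissa different from both ends of its segment lies in (0, 1), where [h] takes its
       values in [Om]. *)
    - destruct (Req_dec (s + k * (s' - s)) s) as [->|N1]; auto.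
      destruct (Req_dec (s + k * (s' - s)) s') as [->|N2]; auto.
      apply Hin; [|lra]. revert Bs. unfold Rmin, Rmax; repeat destruct Rle_dec; lra.
    - revert Bt. unfold Rmin, Rmax; repeat destruct Rle_dec; lra. }
  assert (HEO : forall s t, E s t -> Om (h s t)).
  { intros s t [[H1 H2] H3]. destruct (Req_dec s 0) as [->|]. 
    rewrite Hp by auto. rewrite <- (Hp 0) by lra. auto.
    destruct (Req_dec s 1) as [->|]. rewrite Hq by auto. rewrite <- (Hq 0) by lra. auto.
    apply Hin; auto. lra. }
  assert (HhE : cont_on2 E h).
  { intros s t [[H1 H2] H3] e He. destruct (Hh s t H1 H3 e He) as (d & Hd & K).
    exists d. split; auto. intros s' t' [[H1' H2'] H3'] As At. rewrite <- Cdist_Cmod. auto. }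
  assert (Hbase : E s0 0) by (split; [split; auto; rewrite Hs0z; auto|lra]).
  destruct (convex_lift phi Om E h s0 0 zh Hcov HE HhE HEO Hbase) as (L & HL & L0).
  { rewrite <- Cnorm_Cmod. auto. }
  { congruence. }
  assert (HE1 : forall s t, strip 1 s t -> E s t).
  { intros s t [H1 H2]. split; auto. split. lra. apply Hin; auto. lra. }
  destruct (lift_edge phi Om E h L p Hcov Hhol Hbd Hh Hp HL HE1) as (ph & Bp & Ip & Cp).
  { intros Op t Ht. split; auto. split. lra. rewrite Hp; auto. lra. }
  (* The edge s = 1 is reflected to s = 0. *)
  destruct (lift_edge phi Om (fun s t => E (1 - s) t) (fun s t => h (1 - s) t)
    (fun s t => L (1 - s) t) q Hcov Hhol Hbd (continuous_square_reflect h Hh))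
    as (qh & Bq & Iq & Cq).
  { intros t Ht. rewrite Rminus_0_r. auto. }
  { destruct HL as [LC LD]. split.
    - intros s t Hst e He. destruct (LC _ _ Hst e He) as (d & Hd & K).
      exists d. split; auto. intros s' t' Hst' As At. apply K; auto.
      rewrite <- Rabs_Ropp. replace (- _) with (s' - s) by ring. auto.
    - intros s t Hst. auto. }
  { intros s t [H1 H2]. apply HE1. unfold strip; lra. }
  { intros Oq t Ht. split; auto. split. lra. rewrite Rminus_0_r, Hq; auto. lra. }
  simpl in Iq, Cq. rewrite Rminus_0_r in Iq.
  set (hh := fun s t => if Rle_dec s 0 then ph else if Rle_dec 1 s then qh else L s t).
  assert (hh0 : forall t, hh 0 t = ph).
  { intros t. unfold hh. destruct Rle_dec; auto; lra. }
  assert (hh1 : forall t, hh 1 t = qh).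
  { intros t. unfold hh. destruct Rle_dec; [lra|]. destruct Rle_dec; auto; lra. }
  assert (hhi : forall s t, 0 < s < 1 -> hh s t = L s t).
  { intros s t Hs. unfold hh. destruct Rle_dec; [lra|]. destruct Rle_dec; auto; lra. }
  assert (Hhh : lift_homotopy phi p q zh s0 h hh).
  { repeat split.
    - intros s t Hs Ht e He.
      destruct (Req_dec s 0) as [->|N0]; [|destruct (Req_dec s 1) as [->|N1]].
      + destruct (Cp t Ht e He) as (d & Hd & Hd1 & K). exists d. split; auto.
        intros s' t' Hs' Ht' As At. rewrite Cdist_Cmod, hh0. apply Rabs_def2 in As.
        destruct (Req_dec s' 0) as [->|]. rewrite hh0, Cmod_sub_diag; auto.
        rewrite hhi by lra. apply K; auto; lra.
      + destruct (Cq t Ht e He) as (d & Hd & Hd1 & K). exists d. split; auto.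
        intros s' t' Hs' Ht' As At. rewrite Cdist_Cmod, hh1. apply Rabs_def2 in As.
        destruct (Req_dec s' 1) as [->|]. rewrite hh1, Cmod_sub_diag; auto.
        rewrite hhi by lra. replace s' with (1 - (1 - s')) by ring. apply K; auto; lra.
      + assert (Hst : E s t) by (apply HE1; unfold strip; lra).
        destruct (proj1 HL s t Hst e He) as (d & Hd & K).
        exists (Rmin d (Rmin s (1 - s))). split. repeat apply Rmin_pos; lra.
        generalize (Rmin_l d (Rmin s (1 - s))) (Rmin_r d (Rmin s (1 - s)))
          (Rmin_l s (1 - s)) (Rmin_r s (1 - s)).
        intros M1 M2 M3 M4 s' t' Hs' Ht' As At. rewrite Cdist_Cmod.
        assert (As' := As). apply Rabs_def2 in As'.
        rewrite !hhi by lra. apply K; try lra. apply HE1. unfold strip; lra.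
    - intros s t Hs Ht.
      destruct (Req_dec s 0) as [->|N0]; [|destruct (Req_dec s 1) as [->|N1]].
      + rewrite hh0. eapply phibar_cDisc; eauto.
      + rewrite hh1. eapply phibar_cDisc; eauto.
      + rewrite hhi by lra. unfold cDisc. rewrite Cnorm_Cmod. left. apply HL. apply HE1.
        unfold strip; lra.
    - rewrite hhi by auto. unfold Disc. rewrite Cnorm_Cmod. apply HL, HE1. unfold strip; lra.
    - rewrite hhi by auto. apply HL, HE1. unfold strip; lra.
    - exists ph. auto.
    - exists qh. auto.
    (* For a base point on an edge, the end point there is [z], in [Om], so the edge value is that
       of [L], namely [zh]. *)
    - destruct (Req_dec s0 0) as [E0|N0]; [|destruct (Req_dec s0 1) as [E1|N1]].
      + subst s0. rewrite hh0, Ip; auto. rewrite <- (Hp 0), Hs0z by lra. auto.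
      + subst s0. rewrite hh1, Iq; auto. rewrite <- (Hq 0), Hs0z by lra. auto.
      + rewrite hhi by lra. auto. }
  exists hh. split; auto. intros hh' Hhh'.
  assert (L1 := lift_homotopy_lift_on2 phi p q z zh s0 h hh Hs0 Hp Hq Hs0z Hzh Ez Hhh).
  assert (L2 := lift_homotopy_lift_on2 phi p q z zh s0 h hh' Hs0 Hp Hq Hs0z Hzh Ez Hhh').
  (* By density it is enough to compare on the open strip, where both maps are ordinary lifts with
     the same value at the base point. *)
  apply continuous_square_eq. apply Hhh'. apply Hhh. intros s t Hs Ht.
  apply (lift_on2_unique phi Om (rel_strip s0) h hh' hh s0 0 s t Hcov
    (convex2_rel_strip s0 Hs0) L2 L1).
  - split; auto. lra.
  - split; auto.
  - transitivity zh. apply Hhh'. symmetry. apply Hhh.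
Qed.

Theorem theorem2p4 (Om : Cplx -> Prop) (phi : Cplx -> Cplx)
  (HOmo : Copen_set Om) (HOmc : Cconnected Om) (HOmb : Cbounded Om)
  (Hhol : Cholomorphic_on Disc phi) (Hcov : covering_map phi Om)
  (p q z zh : Cplx) (Hp : Cclosure Om p) (Hq : Cclosure Om q) (Hz : Om z)
  (Hzh : Disc zh) (Hphizh : phi zh = z) :
  (forall (g : R -> Cplx) (s0 : R),
     path_epe Om p q g -> 0 <= s0 <= 1 -> g s0 = z ->
     exists gh : R -> Cplx,
       (path_epe Disc (gh 0) (gh 1) gh /\
        (forall s, 0 <= s <= 1 -> phibar phi (gh s) (g s)) /\
        gh s0 = zh) /\
       (forall gh' : R -> Cplx,
          path_epe Disc (gh' 0) (gh' 1) gh' ->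
          (forall s, 0 <= s <= 1 -> phibar phi (gh' s) (g s)) ->
          gh' s0 = zh ->
          forall s, 0 <= s <= 1 -> gh' s = gh s)) /\
  (forall (h : R -> R -> Cplx) (s0 : R),
     continuous_square h ->
     (forall t, 0 <= t <= 1 -> path_epe Om p q (fun s => h s t)) ->
     0 <= s0 <= 1 -> h s0 0 = z ->
     exists hh : R -> R -> Cplx,
       lift_homotopy phi p q zh s0 h hh /\
       (forall hh' : R -> R -> Cplx, lift_homotopy phi p q zh s0 h hh' ->
          forall s t, 0 <= s <= 1 -> 0 <= t <= 1 -> hh' s t = hh s t)).
Proof.
  assert (H2 : forall (h : R -> R -> Cplx) (s0 : R), continuous_square h ->
     (forall t, 0 <= t <= 1 -> path_epe Om p q (fun s => h s t)) ->
     0 <= s0 <= 1 -> h s0 0 = z ->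
     exists hh : R -> R -> Cplx,
       lift_homotopy phi p q zh s0 h hh /\
       (forall hh' : R -> R -> Cplx, lift_homotopy phi p q zh s0 h hh' ->
          forall s t, 0 <= s <= 1 -> 0 <= t <= 1 -> hh' s t = hh s t)).
  { intros h s0 Hh Hpath Hs0 Hs0z.
    exact (homotopy_lift Om phi p q z zh h s0 HOmb Hhol Hcov Hz Hzh Hphizh Hh Hpath Hs0 Hs0z). }
  split; auto.
  intros g s0 Hg Hs0 Hgz.
  assert (Hsq : forall c : R -> Cplx, continuous_path c -> continuous_square (fun s _ => c s)).
  { intros c Hc s t Hs Ht e He. destruct (Hc s Hs e He) as (d & Hd & K).
    exists d. split; auto. }
  destruct Hg as (G0 & G1 & GC & GO).
  destruct (H2 (fun s _ => g s) s0) as (hh & (HC & _ & Hin & (ph & Hph & Bp) & (qh & Hqh & Bq) & E0) & Huniq);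
    auto.
  { intros t _. repeat split; auto. }
  exists (fun s => hh s 0). split.
  - split; [|split; auto].
    + repeat split.
      * intros s Hs e He. destruct (HC s 0 Hs ltac:(lra) e He) as (d & Hd & K).
        exists d. split; auto. intros s' Hs' As. apply K; auto. lra. rewrite Rminus_diag, Rabs_R0; auto.
      * intros s Hs. apply Hin; auto. lra.
    + intros s Hs. destruct (Req_dec s 0) as [->|N0]; [|destruct (Req_dec s 1) as [->|N1]].
      * rewrite Hph, G0 by lra. auto.
      * rewrite Hqh, G1 by lra. auto.
      * left. apply Hin; lra.
  (* A competing path, repeated for every [t], is a competing lift of the homotopy. *)
  - intros gh' (_ & _ & C' & D') B' E' s Hs.
    apply (Huniq (fun s _ => gh' s)); auto; [|lra].
    split; [auto|]. split; [|split; [|split; [|split; auto]]].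
    + intros u t Hu Ht. eapply phibar_cDisc. apply B'; auto.
    + intros u t Hu Ht. split; auto.
      (* At interior parameters the path lies in the disc, which rules out the radial limit
         alternative of [phibar]. *)
      destruct (B' u ltac:(lra)) as [[_ K]|[K _]]; auto.
      specialize (D' u Hu). unfold Disc in D'. lra.
    + exists (gh' 0). split; auto. rewrite <- G0. apply B'; lra.
    + exists (gh' 1). split; auto. rewrite <- G1. apply B'; lra.
Qed.
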